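(* Let $K$ be a compact subset of $\mathbb{R}^n$, $n \geq 1$, let $q \in \mathbb{R}$, and suppose $\operatorname{Cap}_q(K)>0$. For each relevant exponent $p$, let $\mu_p$ denote the $p$-equilibrium measure of $K$. (a) (Continuity) If $-2<q<0$ then $p \mapsto \mu_p$ is weak-$*$ continuous at $p=q$, that is, $\mu_p \to \mu_q$ weak-$*$ as $p \to q$. (b) (Left-continuity) If $q \geq 0$ then $p \mapsto \mu_p$ is weak-$*$ left-continuous at $p=q$, that is, $\mu_p \to \mu_q$ weak-$*$ as $p \nearrow q$. (c) (Right-continuity) If $q \geq 0$ and for some $q_*>q$ the equilibrium measure $\mu_q$ satisfies $$\int_K \int_K \frac{1}{|x-y|^{q_*}} \, d\mu_q(x) \, d\mu_q(y) < \infty ,$$ then $p \mapsto \mu_p$ is weak-$*$ right-continuous at $p=q$, that is, $\mu_p \to \mu_q$ weak-$*$ as $p \searrow q$.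
   Context: Let $K \subset \mathbb{R}^n$ be compact. A probability measure on $K$ means a positive unit Borel measure on $K$. Logarithmic energy: $V_{\log}(K) = \min_\mu \int_K \int_K \log \frac{1}{|x-y|} \, d\mu(x) \, d\mu(y)$, the minimum being over all probability measures $\mu$ on $K$ (value in $(-\infty,+\infty]$, with the kernel equal to $+\infty$ when $x=y$); $V_{\log}(\emptyset) = +\infty$. Riesz $p$-energy, for $p \in \mathbb{R}\setminus\{0\}$: $V_p(K) = \min_\mu \int_K \int_K |x-y|^{-p} \, d\mu(x) \, d\mu(y)$ if $p>0$ (value in $(0,+\infty]$, with the kernel equal to $+\infty$ when $x=y$), and $V_p(K) = \max_\mu \int_K \int_K |x-y|^{-p} \, d\mu(x) \, d\mu(y)$ if $p<0$, the minimum and maximum being over all probability measures $\mu$ on $K$. By convention $V_p(\emptyset) = +\infty$ for $p>0$ and $V_p(\emptyset)=0$ for $p<0$. Riesz $p$-capacity: $\operatorname{Cap}_p(K) = V_p(K)^{-1/p}$ for $p \neq 0$, and $\operatorname{Cap}_0(K) = \exp(-V_{\log}(K))$ (logarithmic capacity), with the conventions $(+\infty)^{-1/p} = 0$ for $p>0$ and $\exp(-\infty)=0$. Equilibrium measure: it is a known fact that there is exactly one probability measure on $K$ attaining the extremum in the definition of $V_p(K)$ (of $V_{\log}(K)$ when $p=0$) in each of these cases: $p \geq 0$ and $\operatorname{Cap}_p(K)>0$ (equivalently, the energy is finite); or $-2<p<0$ and $K$ nonempty. This unique measure is called the $p$-equilibrium measure of $K$ and denoted $\mu_p$. In each part of the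 claim, the limits are taken over exponents $p$ close enough to $q$ (on the indicated side), with $p>-2$ and, in part (c), $p<q_*$, so that $\mu_p$ exists and is unique. Weak-$*$ convergence $\mu_p \to \mu_q$ means $\int_K f \, d\mu_p \to \int_K f \, d\mu_q$ for every continuous function $f$ on $K$. *)

(* Defs.v *)
From HB Require Import structures.
From mathcomp Require Import all_boot all_order all_algebra.
From mathcomp Require Import all_classical all_reals all_analysis.
Set Implicit Arguments.
Unset Strict Implicit.
Unset Printing Implicit Defensive.
Import Order.TTheory GRing.Theory Num.Theory.
Import numFieldNormedType.Exports.
Local Open Scope classical_set_scope.
Local Open Scope ring_scope.

(* The library norm on 'rV[R]_n is the sup norm; it induces the usual topology,
   but the energies below need the Euclidean length. *)
Definition enorm (R : realType) (n : nat) (x : 'rV[R]_n) : R :=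
  Num.sqrt (\sum_(i < n) x ord0 i ^+ 2).

Notation borelRn R n := (g_sigma_algebraType (@open 'rV[R]_n)).

(* A Borel probability measure on a compact K is represented by a Borel
   probability measure on R^n giving K full mass. *)
Definition prob_on (R : realType) (n : nat) (K : set 'rV[R]_n)
    (mu : probability (borelRn R n) R) : Prop :=
  mu K = 1%E.

Definition log_kernel (R : realType) (n : nat) (x y : 'rV[R]_n) : \bar R :=
  if x == y then +oo%E else (ln (enorm (x - y))^-1)%:E.

(* Since [0 `^ (- p) = 0] in the library for every [p != 0], the diagonal needs
   a special case when [0 < p]. *)
Definition riesz_kernel (R : realType) (n : nat) (p : R) (x y : 'rV[R]_n) :
    \bar R :=
  if (0 < p) && (x == y) then +oo%E else (enorm (x - y) `^ (- p))%:E.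

Definition log_energy_of (R : realType) (n : nat) (K : set 'rV[R]_n)
    (mu : probability (borelRn R n) R) : \bar R :=
  (\int[mu]_(x in K) \int[mu]_(y in K) log_kernel x y)%E.

Definition riesz_energy_of (R : realType) (n : nat) (p : R) (K : set 'rV[R]_n)
    (mu : probability (borelRn R n) R) : \bar R :=
  (\int[mu]_(x in K) \int[mu]_(y in K) riesz_kernel p x y)%E.

(* The extrema are written as infima and suprema in \bar R, so that the infimum
   over an empty set of measures is +oo; for compact nonempty K they are
   attained. *)
Definition log_energy (R : realType) (n : nat) (K : set 'rV[R]_n) : \bar R :=
  ereal_inf [set log_energy_of K mu | mu in prob_on K].

Definition riesz_energy (R : realType) (n : nat) (p : R) (K : set 'rV[R]_n) :
    \bar R :=
  if 0 < p then ereal_inf [set riesz_energy_of p K mu | mu in prob_on K]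
  else if `[< K = set0 >] then 0%E
  else ereal_sup [set riesz_energy_of p K mu | mu in prob_on K].

(* The library has [+oo `^ r = +oo] also for [r < 0], whence the test. *)
Definition capacity (R : realType) (n : nat) (p : R) (K : set 'rV[R]_n) :
    \bar R :=
  if p == 0 then expeR (- log_energy K)%E
  else if riesz_energy p K == +oo%E then 0%E
  else poweR (riesz_energy p K) (- p^-1).

Definition attains_energy (R : realType) (n : nat) (p : R) (K : set 'rV[R]_n)
    (mu : probability (borelRn R n) R) : Prop :=
  prob_on K mu /\
  if p == 0 then log_energy_of K mu = log_energy K
  else riesz_energy_of p K mu = riesz_energy p K.

(* Uniqueness is agreement on Borel sets: the underlying functions of measures
   in the library are unconstrained on nonmeasurable sets. *)
Definition is_equilibrium_measure (R : realType) (n : nat) (p : R)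
    (K : set 'rV[R]_n) (mu : probability (borelRn R n) R) : Prop :=
  attains_energy p K mu /\
  forall nu : probability (borelRn R n) R, attains_energy p K nu ->
    forall A : set (borelRn R n), measurable A -> nu A = mu A.

(* The exponents for which K has exactly one extremal measure. *)
Definition equilibrium_exponent (R : realType) (n : nat) (K : set 'rV[R]_n)
    (p : R) : Prop :=
  (0 <= p /\ (0 < capacity p K)%E) \/ (-2 < p < 0 /\ K !=set0).

Definition weak_star_cvg (R : realType) (n : nat) (K : set 'rV[R]_n)
    (mu : R -> probability (borelRn R n) R) (F : set_system R)
    (nu : probability (borelRn R n) R) : Prop :=
  forall f : 'rV[R]_n -> R, {within K, continuous f} ->
    (\int[mu p]_(x in K) f x)%R @[p --> F] --> (\int[nu]_(x in K) f x)%R.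

(* Main.v *)
Require Import Defs.
From HB Require Import structures.
From mathcomp Require Import all_boot all_order all_algebra.
From mathcomp Require Import all_classical all_reals all_analysis.
From mathcomp Require Import measurable_realfun.
From mathcomp Require Import ring lra.
Import Order.TTheory GRing.Theory Num.Theory.
Import numFieldNormedType.Exports.
Local Open Scope classical_set_scope.
Local Open Scope ring_scope.

Set Implicit Arguments.
Unset Strict Implicit.
Unset Printing Implicit Defensive.

(** For all exponents p > -2 at once, the p-equilibrium measure minimizes the double integral
    of one kernel: k_p(t) = (t^(-p) - 1) / p for p <> 0, and k_0(t) = - log t, where t = |x - y|.
    Dividing by p turns the maximum for p < 0 into a minimum and makes the logarithm the
    limiting case. Written with a = - log t, k_p is the slope (e^(pa) - 1) / p of the convex
    function p |-> e^(pa) between 0 and p, so it is nondecreasing and continuous in p. On a set of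
    diameter at most D, k_p >= k_(-2) >= (1 - D^2) / 2, so adding D^2 / 2 makes every kernel
    nonnegative on K; J_p denotes the resulting energy ([shifted_energy], [attains_energyP]).

    Compactness of the set of probability measures on K gives, along any ultrafilter U finer than
    the filter under study, a limit nu of the mu_p. By uniqueness of mu_q it suffices to show
    J_q(nu) <= J_q(mu_q). Each J_r is lower semicontinuous, since k_r is an increasing limit of the
    continuous kernels k_r(max(t, 1/m)) ([shifted_energy_lsc]).
    - From the left: for r < p < q,
        J_r(mu_p) <= J_p(mu_p) <= J_p(mu_q) <= J_q(mu_q),
      so J_r(nu) <= J_q(mu_q) for every r < q, and monotone convergence r -> q concludes
      ([weak_star_left]).
    - From the right: for p > q, J_q(mu_p) <= J_p(mu_p) <= J_p(mu_q), and J_p(mu_q) -> J_q(mu_q) as p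
      decreases to q, by dominated convergence with the kernel of the exponent q_* as dominating
      function ([weak_star_right]). For q < 0 the kernels are bounded, and q / 2 serves as q_*.

    The limit nu ([prob_ultra_limit]) is built without a representation theorem. Countably many
    small open sets give each point of K a binary code, words cut K into cells, and the limits m(w)
    along U of the masses mu_p(cell w) are additive. Subdividing [0, 1[ into intervals of lengths
    m(w) and sending u to the point of K whose successive cells are the intervals containing u
    defines a map X; nu is the law of X under Lebesgue measure. A Riemann sum over cells compares
    energies for mu_p and for nu. *)

(** * Binary codes of points of a compact set *)

(** Balls of rational centre and radius 1/(k+1); interiors are taken because the balls of a
    pseudometric need not be open. *)
Lemma countable_small_opens (R : realType) (n : nat) :
  exists B : nat -> set 'rV[R]_n, (forall j, open (B j)) /\
    forall x (e : R), 0 < e -> exists2 j, B j x &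
      forall y z, B j y -> B j z -> ball y e z.
Proof.
pose B j := (if @unpickle ('rV[rat]_n * nat)%type j is Some (c, k)
  then (ball (map_mx ratr c : 'rV[R]_n) (k.+1%:R^-1 : R))^° else set0).
exists B; split=> [j|x e e0].
  rewrite /B; case: unpickle => [[c k]|]; [exact: open_interior|exact: open0].
have [k _ Hk] := near_infty_natSinv_lt (PosNum (divr_gt0 e0 (ltr0n R 2))).
have {}Hk : (k.+1%:R^-1 : R) < e / 2 by apply: (Hk k) => /=.
set r : R := k.+1%:R^-1.
have r0 : 0 < r by rewrite invr_gt0.
have Hq (i : 'I_n) : exists q : rat, `|ratr q - x ord0 i| < r / 2.
  have xx : x ord0 i - r / 2 < x ord0 i + r / 2 by lra.
  have [q] := rat_in_itvoo xx; rewrite in_itv /= => /andP[q1 q2].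
  by exists q; rewrite ltr_norml; apply/andP; split; lra.
have [f Hf] := choice Hq.
exists (pickle ((\row_i f i, k) : ('rV[rat]_n * nat)%type)).
  rewrite /B pickleK /interior /=; apply/nbhs_ballP; exists (r / 2) => /=; first by lra.
  move=> y [_ xy]; split=> // i j; rewrite (ord1 i) /ball /= mxE mxE.
  have := xy ord0 j; rewrite /ball /= => H; have := Hf j => H'.
  rewrite -/r; apply: le_lt_trans (ler_distD (x ord0 j) _ _) _.
  by rewrite (splitr r) ltrD.
rewrite /B pickleK => y z /interior_subset By /interior_subset Bz.
apply: (@le_ball _ _ _ (r + r)); first (rewrite [e]splitr; exact/ltW/ltrD).
by apply: ball_triangle Bz; exact: ball_sym.
Qed.

(** Finitely many sets of diameter less than e among the B j cover K, and two points with the same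
    answers to these finitely many tests lie in a common one. *)
Lemma compact_mesh (R : realType) (n : nat) (K : set 'rV[R]_n) : compact K ->
  exists B : nat -> set 'rV[R]_n, (forall j, open (B j)) /\
    forall e : R, 0 < e -> exists N : nat, forall x y, K x -> K y ->
      (forall j, (j < N)%N -> `[< B j x >] = `[< B j y >]) -> ball x e y.
Proof.
move=> cK; have [B [oB HB]] := countable_small_opens R n; exists B; split => // e e0.
move: cK; rewrite compact_cover => /(_ nat
  [set j | forall y z, B j y -> B j z -> ball y e z] B).
case=> [j _|x Kx|D DP KD]; first exact: oB.
  by have [j Bjx Hj] := HB x e e0; exists j.
exists (\max_(j <- finmap.enum_fset D) j).+1 => x y Kx Ky xy.
have [j /= jD Bjx] := KD x Kx.
have jP := DP j jD; move: jP; rewrite inE => /(_ x y); apply => //.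
have : (j < (\max_(j <- finmap.enum_fset D) j).+1)%N.
  by rewrite ltnS; apply: leq_bigmax_seq.
by move=> /xy; rewrite (asboolT Bjx) => /esym/asboolP.
Qed.

Section binary_codes.
Variables (T : Type) (B : nat -> set T).

(** The answers to the first k tests, most recent first, so that a refinement is a [cons]. *)
Fixpoint code (x : T) (k : nat) : seq bool :=
  if k is k'.+1 then `[< B k' x >] :: code x k' else [::].

Definition cell (w : seq bool) : set T := [set x | code x (size w) = w].

Lemma size_code x k : size (code x k) = k.
Proof. by elim: k => //= k ->. Qed.

Lemma cell_code x k : cell (code x k) x.
Proof. by rewrite /cell /= size_code. Qed.

Lemma cell_nil : cell [::] = setT.
Proof. by apply/seteqP. Qed.

Lemma cell_cons b w :
  cell (b :: w) = cell w `&` [set x | `[< B (size w) x >] = b].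
Proof.
apply/seteqP; split => x; rewrite /cell /=; first by case=> -> ->.
by case=> -> ->.
Qed.

Lemma cell_split w : cell w = cell (false :: w) `|` cell (true :: w).
Proof.
rewrite !cell_cons -setIUr; apply/esym/setIidl => x _ /=.
by case: `[< _ >]; [right|left].
Qed.

Lemma cell_disj w : cell (false :: w) `&` cell (true :: w) = set0.
Proof.
by rewrite !cell_cons; apply/seteqP; split => // x /= [[_ ->] [_]].
Qed.

Lemma code_eqP x y k : code x k = code y k <->
  forall j, (j < k)%N -> `[< B j x >] = `[< B j y >].
Proof.
split.
  elim: k => // k IH /= [e1 e2] j; rewrite ltnS leq_eqVlt => /predU1P[->|]//.
  exact: IH.
elim: k => //= k IH H; rewrite H// IH// => j jk; apply: H; exact: ltnW.
Qed.

End binary_codes.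

(** * Subdivisions of the unit interval indexed by words *)

Section binary_subdivision.
Variables (R : realType) (m : seq bool -> R).

(** The interval of a word [w] is [left_end w, left_end w + m w[; the interval of [true :: w] lies to
    the right of that of [false :: w]. *)
Fixpoint left_end (w : seq bool) : R :=
  if w is b :: w' then left_end w' + (if b then m (false :: w') else 0) else 0.

(** The word of length k whose interval contains u. *)
Fixpoint locate (u : R) (k : nat) : seq bool :=
  if k is k'.+1 then
    (left_end (true :: locate u k') <= u) :: locate u k'
  else [::].

Hypotheses (m_ge0 : forall w, 0 <= m w) (m_nil : m [::] = 1)
  (m_split : forall w, m w = m (false :: w) + m (true :: w)).

Lemma size_locate u k : size (locate u k) = k.
Proof. by elim: k => //= k ->. Qed.

Lemma left_end_ge0 w : 0 <= left_end w.
Proof.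
by elim: w => //= b w IH; rewrite addr_ge0//; case: b.
Qed.

Lemma left_end_le1 w : left_end w + m w <= 1.
Proof.
elim: w => [|b w /=]; first by rewrite /= m_nil add0r.
have := m_split w; have := m_ge0 (true :: w); have := m_ge0 (false :: w).
by case: b => *; lra.
Qed.

Lemma locateP u k : 0 <= u < 1 ->
  left_end (locate u k) <= u < left_end (locate u k) + m (locate u k).
Proof.
move=> u01; elim: k => [|k]; first by rewrite /= m_nil add0r.
rewrite /=; set w := locate u k; have mw := m_split w.
move=> /andP[h1 h2]; case: (leP (_ + m (false :: _))) => /= h; apply/andP; split; lra.
Qed.

Lemma locate_uniq u w :
  left_end w <= u < left_end w + m w -> locate u (size w) = w.
Proof.
elim: w => //= b w IH /andP[h1 h2].
have := m_split w; have := m_ge0 (true :: w); have := m_ge0 (false :: w).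
move=> m0 m1 mw; rewrite IH; last by case: b h1 h2 => /= ? ?; apply/andP; split; lra.
by congr (_ :: _); case: b h1 h2 => /= h1 h2; [|apply/negbTE; rewrite -ltNge]; lra.
Qed.

End binary_subdivision.

Section unif.
Variable (R : realType).

Definition unif01 := mrestr (@lebesgue_measure R)
  (measurable_itv `[0%R, 1%R[ : measurable (`[0, 1[%classic : set R)).

HB.instance Definition _ := Measure.on unif01.

Lemma unif01T : unif01 setT = 1%E.
Proof.
by rewrite /unif01 /mrestr setTI lebesgue_measure_itv /= lte_fin ltr01 -EFinB subr0.
Qed.

HB.instance Definition _ := Measure_isProbability.Build _ _ _ unif01 unif01T.

End unif.

(** * Double integrals against a product of probability measures *)

Section finite_valued.
Context d (T : measurableType d) (R : realType) (P : probability T R)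
  (F : finType) (W : T -> F).
Hypothesis mW : forall w, measurable (W @^-1` [set w]).

Lemma finite_valued_sum (g : F -> R) (t : T) :
  g (W t) = \sum_(w : F) g w * \1_(W @^-1` [set w]) t.
Proof.
rewrite (bigD1 (W t))//= indicE mem_set// mulr1 big1 ?addr0// => w wt.
rewrite indicE memNset ?mulr0//= => wt'; move: wt; rewrite wt'.
by rewrite eqxx.
Qed.

Lemma measurable_finite_valued (g : F -> R) :
  measurable_fun setT (EFin \o (g \o W)).
Proof.
apply/measurable_EFinP.
rewrite (_ : g \o W =
  (fun t => \sum_(w : F) g w * \1_(W @^-1` [set w]) t)); last first.
  by apply/funext => t; exact: finite_valued_sum.
by apply: measurable_sum => w; apply: measurable_funM.
Qed.

Lemma integral_finite_valued (g : F -> R) : (forall w, 0 <= g w) ->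
  (\int[P]_t (g (W t))%:E)%E = (\sum_(w : F) g w * fine (P (W @^-1` [set w])))%:E.
Proof.
move=> g0; under eq_integral do rewrite finite_valued_sum -sumEFin.
rewrite ge0_integral_sum//; first last.
- by move=> w t _; rewrite lee_fin mulr_ge0// indicE.
- move=> w; apply/measurable_EFinP; exact: measurable_funM.
rewrite -sumEFin; apply: eq_bigr => w _.
under eq_integral do rewrite EFinM.
rewrite ge0_integralZl//; first last.
- by rewrite lee_fin.
- by apply/measurable_EFinP; exact: measurable_indic.
rewrite integral_indic// setIT EFinM fineK//.
exact: fin_num_measure.
Qed.

End finite_valued.

Lemma integral_full (d : measure_display) (T : measurableType d) (R : realType)
  (P : probability T R) (K : set T) (f : T -> \bar R) : measurable K -> P K = 1%E ->
  measurable_fun setT f -> (forall x, 0 <= f x)%E ->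
  (\int[P]_(x in K) f x = \int[P]_x f x)%E.
Proof.
move=> mK PK mf f0; have mKC := measurableC mK.
rewrite (@ge0_negligible_integral _ _ _ _ setT (~` K))//; last first.
  by apply: etrans (probability_setC P mK) _; rewrite PK subee.
by rewrite setTD setCK.
Qed.

Section energy.
Context d (T : measurableType d) (R : realType).

(** Integration against the product measure gives access to the convergence theorems for a single
    integral; [energyE] recovers the iterated integral. *)
Definition energy (K : set T) (k : T * T -> \bar R) (mu : probability T R) :
  \bar R := (\int[mu \x mu]_(z in K `*` K) k z)%E.

Variables (K : set T) (mK : measurable K).

Lemma energyE (k : T * T -> \bar R) (mu : probability T R) :
  measurable_fun (K `*` K) k -> (forall x y, K x -> K y -> 0 <= k (x, y))%E ->
  (\int[mu]_(x in K) \int[mu]_(y in K) k (x, y) = energy K k mu)%E.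
Proof.
move=> mk k0; have mKK : measurable (K `*` K) by exact: measurableX.
rewrite /energy integral_mkcond [RHS]integral_mkcond.
rewrite fubini_tonelli1; first last.
- move=> [x y]; rewrite patchE; case: ifPn => //; rewrite inE => -[/=].
  exact: k0.
- exact/(measurable_restrictT _ mKK).
apply: eq_integral => x _; rewrite patchE /fubini_F.
case: ifPn => [|xK].
  rewrite inE => Kx; rewrite [LHS]integral_mkcond; apply: eq_integral => y _.
  rewrite !patchE; congr (if _ then _ else _).
  by apply/idP/idP; rewrite !inE //= => -[].
rewrite (eq_integral (cst 0%E)) ?integral0// => y _; rewrite patchE memNset//=.
by case=> Kx _; move: xK; rewrite mem_set.
Qed.

Lemma measurable_section_integral (k : T * T -> \bar R) (mu : probability T R) :
  measurable_fun (K `*` K) k -> (forall x y, K x -> K y -> 0 <= k (x, y))%E ->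
  measurable_fun K (fun x => \int[mu]_(y in K) k (x, y))%E.
Proof.
move=> mk k0; have mKK : measurable (K `*` K) by exact: measurableX.
have mk' : measurable_fun setT (k \_ (K `*` K)) by exact/(measurable_restrictT _ mKK).
apply: (@eq_measurable_fun _ _ _ _ _ (fubini_F mu (k \_ (K `*` K)))).
  move=> x; rewrite inE => Kx; rewrite /fubini_F [RHS]integral_mkcond.
  apply: eq_integral => y _; rewrite !patchE; congr (if _ then _ else _).
  by apply/idP/idP; rewrite !inE //= => -[].
apply: measurable_funTS; apply: measurable_fun_fubini_tonelli_F => // -[x y].
by rewrite patchE; case: ifPn => //; rewrite inE => -[/=]; exact: k0.
Qed.

Lemma energy_le (k1 k2 : T * T -> \bar R) (mu : probability T R) :
  measurable_fun (K `*` K) k1 -> measurable_fun (K `*` K) k2 ->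
  (forall x y, K x -> K y -> 0 <= k1 (x, y))%E ->
  (forall x y, K x -> K y -> k1 (x, y) <= k2 (x, y))%E ->
  (energy K k1 mu <= energy K k2 mu)%E.
Proof.
move=> m1 m2 k10 k12; apply: ge0_le_integral => //; first exact: measurableX.
- by move=> [x y] [/= ? ?]; exact: k10.
- by move=> [x y] [/= ? ?]; exact: k12.
Qed.

Lemma energyD (k1 k2 : T * T -> \bar R) (mu : probability T R) :
  measurable_fun (K `*` K) k1 -> measurable_fun (K `*` K) k2 ->
  (forall x y, K x -> K y -> 0 <= k1 (x, y))%E ->
  (forall x y, K x -> K y -> 0 <= k2 (x, y))%E ->
  (energy K (fun z => k1 z + k2 z) mu = energy K k1 mu + energy K k2 mu)%E.
Proof.
move=> m1 m2 k10 k20; apply: ge0_integralD => //; first exact: measurableX.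
- by move=> [x y] [/= ? ?]; exact: k10.
- by move=> [x y] [/= ? ?]; exact: k20.
Qed.

Lemma energyZ (c : R) (k : T * T -> \bar R) (mu : probability T R) :
  0 <= c -> measurable_fun (K `*` K) k ->
  (forall x y, K x -> K y -> 0 <= k (x, y))%E ->
  (energy K (fun z => c%:E * k z) mu = c%:E * energy K k mu)%E.
Proof.
move=> c0 mk k0; apply: ge0_integralZl_EFin => //; first exact: measurableX.
by move=> [x y] [/= ? ?]; exact: k0.
Qed.

Lemma energy_cst (mu : probability T R) (c : R) : mu K = 1%E ->
  energy K (cst c%:E) mu = c%:E.
Proof.
move=> muK; rewrite /energy integral_cst; last exact: measurableX.
by rewrite (_ : _ (K `*` K) = 1%E) ?mule1//; apply: etrans (product_measure1E _ _ mK mK) _;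
  exact: etrans (congr2 mule muK muK) (mule1 _).
Qed.

Lemma energy_le_addc (k1 k2 : T * T -> \bar R) (mu : probability T R) (c : R) :
  mu K = 1%E -> measurable_fun (K `*` K) k1 -> measurable_fun (K `*` K) k2 ->
  (forall x y, K x -> K y -> 0 <= k1 (x, y))%E ->
  (forall x y, K x -> K y -> 0 <= k2 (x, y))%E -> 0 <= c ->
  (forall x y, K x -> K y -> k1 (x, y) <= k2 (x, y) + c%:E)%E ->
  (energy K k1 mu <= energy K k2 mu + c%:E)%E.
Proof.
move=> muK m1 m2 k10 k20 c0 k12.
have mc : measurable_fun (K `*` K) (cst c%:E : T * T -> \bar R) by exact: measurable_cst.
rewrite -(energy_cst c muK) -energyD//.
apply: energy_le => //; exact: emeasurable_funD.
Qed.

End energy.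

Lemma measurable_finite_valued2 d (T : measurableType d) (R : realType)
  (F : finType) (W : T -> F) (G : F -> F -> R) :
  (forall w, measurable (W @^-1` [set w])) ->
  measurable_fun setT (fun z : T * T => (G (W z.1) (W z.2))%:E).
Proof.
move=> mW; apply: (@measurable_finite_valued _ _ R _ (fun z : T * T => (W z.1, W z.2)) _
    (fun p => G p.1 p.2)).
move=> [w v]; rewrite (_ : _ @^-1` _ = (W @^-1` [set w]) `*` (W @^-1` [set v])).
  exact: measurableX.
by apply/seteqP; split => -[x y] /= [-> ->].
Qed.

(** A kernel that sees points only through a finite-valued W integrates to a Riemann sum, a
    polynomial in the masses of the fibres of W; it therefore converges when these masses do. *)
Lemma energy_finite_valued d (T : measurableType d) (R : realType) (mu : probability T R)
  (K : set T) (F : finType) (W : T -> F) (G : F -> F -> R) :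
  (forall w, measurable (W @^-1` [set w])) ->
  measurable K -> mu K = 1%E -> (forall w v, 0 <= G w v) ->
  energy K (fun z => (G (W z.1) (W z.2))%:E) mu =
  (\sum_(w : F) (\sum_(v : F) G w v * fine (mu (W @^-1` [set v]))) *
     fine (mu (W @^-1` [set w])))%:E.
Proof.
move=> mW mK muK G0; have mG := measurable_finite_valued2 G mW.
rewrite -energyE//; [|exact: measurable_funS mG|by move=> x y _ _; rewrite lee_fin].
set g := fun w => \sum_(v : F) G w v * fine (mu (W @^-1` [set v])).
have g0 w : 0 <= g w.
  by apply: sumr_ge0 => v _; rewrite mulr_ge0// fine_ge0.
under eq_integral => x _.
  rewrite (integral_full mK muK (measurable_finite_valued mW (G (W x)))); last first.
    by move=> y; rewrite lee_fin; exact: G0.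
  rewrite (integral_finite_valued mu mW (G0 (W x))) -/(g (W x)).
  over.
apply: etrans (integral_finite_valued mu mW g0).
apply: (integral_full mK muK (measurable_finite_valued mW g)) => x.
by rewrite lee_fin; exact: g0.
Qed.

(** * Limits of probability measures along an ultrafilter *)

Lemma fmap_ultra (I J : Type) (f : I -> J) (U : set_system I) :
  UltraFilter U -> UltraFilter (fmap f U).
Proof.
move=> UU; split; first exact: fmap_proper_filter.
move=> G PG UG; apply/seteqP; split => // A GA.
have [//|nA] := in_ultra_setVsetC (f @^-1` A) UU.
have /filterI/(_ GA) : G (~` A) by exact: UG.
by rewrite setICl => /filter_not_empty.
Qed.

Lemma ultra_bounded_cvg (R : realType) (I : Type) (U : set_system I) (f : I -> R) (a b : R) :
  UltraFilter U -> (\forall i \near U, a <= f i <= b) ->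
  exists l : R, f @ U --> l.
Proof.
move=> UU fab; have := @segment_compact R a b; rewrite compact_ultra.
move=> /(_ (fmap f U) (fmap_ultra f UU)) [|l [_ /= fl]]; last by exists l.
by apply: filterS fab => i /=; rewrite in_itv.
Qed.

Lemma open_borel (R : realType) (n : nat) (A : set 'rV[R]_n) : open A ->
  measurable (A : set (borelRn R n)).
Proof. by move=> oA; exact: sub_gen_smallest. Qed.

Lemma closed_borel (R : realType) (n : nat) (A : set 'rV[R]_n) : closed A ->
  measurable (A : set (borelRn R n)).
Proof.
move=> cA; rewrite -[A]setCK; apply: measurableC; apply: open_borel.
exact: closed_openC.
Qed.

Lemma compact_borel (R : realType) (n : nat) (A : set 'rV[R]_n) : compact A ->
  measurable (A : set (borelRn R n)).
Proof.
move=> cA; apply: closed_borel; apply: compact_closed cA.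
exact: norm_hausdorff.
Qed.

Section limit_masses.
Context d (T : measurableType d) (R : realType) (B : nat -> set T).
Hypothesis mB : forall j, measurable (B j).
Variables (I : Type) (U : set_system I) (UU : UltraFilter U) (mu : I -> probability T R).

Lemma measurable_cell w : measurable (cell B w).
Proof.
elim: w => [|b w IH]; first by rewrite cell_nil.
rewrite cell_cons; apply: measurableI => //; case: b.
  by rewrite (_ : [set x | _] = B (size w))//; apply/seteqP; split => x /=; case: asboolP.
rewrite (_ : [set x | _] = ~` B (size w)); first exact: measurableC.
by apply/seteqP; split => x /=; case: asboolP.
Qed.

(** Additivity passes to the limit even though the limits m w need not be the cell masses of any
    measure: mass may concentrate on boundaries of cells. *)
Lemma limit_mass : exists m : seq bool -> R,
  [/\ forall w, (fine (mu i (cell B w))) @[i --> U] --> m w,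
   forall w, 0 <= m w, m [::] = 1 &
   forall w, m w = m (false :: w) + m (true :: w)].
Proof.
have mu01 w i : 0 <= fine (mu i (cell B w)) <= 1.
  rewrite fine_ge0//= -lee_fin fineK ?fin_num_measure//; last exact: measurable_cell.
  exact/probability_le1/measurable_cell.
have [m mP] := choice (fun w =>
  ultra_bounded_cvg (f := fun i => fine (mu i (cell B w))) UU (nearW _ (mu01 w))).
exists m; split => //.
- move=> w; apply: cvgr_to_ge (mP w) _; apply: nearW => i.
  by have /andP[] := mu01 w i.
- have := mP [::]; under eq_fun do rewrite cell_nil probability_setT/=.
  by move=> h; apply: (cvg_unique _ h) => //; exact: cvg_cst.
- move=> w; apply: (cvg_unique _ (mP w)) => //.
  rewrite (_ : (fun i => _) =
    (fun i => fine (mu i (cell B (false :: w))) + fine (mu i (cell B (true :: w))))).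
    exact: cvgD.
  apply/funext => i; rewrite (cell_split B w) measureU ?fineD ?fin_num_measure//;
    try exact: measurable_cell.
  exact: cell_disj.
Qed.

End limit_masses.

Section uniform_digits.
Context (R : realType) (m : seq bool -> R).
Hypotheses (m_ge0 : forall w, 0 <= m w) (m_nil : m [::] = 1)
  (m_split : forall w, m w = m (false :: w) + m (true :: w)).

(** Outside [0, 1[, where the Lebesgue measure used below vanishes, u is replaced by 0, so that every
    address has positive mass. *)
Definition address (u : R) (k : nat) : seq bool :=
  locate m (if 0 <= u < 1 then u else 0) k.

Lemma size_address u k : size (address u k) = k.
Proof. exact: size_locate. Qed.

Lemma address_gt0 u k : 0 < m (address u k).
Proof.
rewrite /address; set v := if _ then _ else _.
have v01 : 0 <= v < 1 by rewrite /v; case: ifPn => //; rewrite lexx ltr01.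
have /andP[h1 h2] := locateP m_nil m_split k v01.
by rewrite -(ltrD2l (left_end m (locate m v k))) addr0 (le_lt_trans h1).
Qed.

Lemma address_in w : [set u | address u (size w) = w] `&` `[0, 1[ =
  `[left_end m w, left_end m w + m w[%classic.
Proof.
apply/seteqP; split => u /=.
  rewrite /address in_itv/= => -[+ u01]; rewrite u01 => uw.
  by have := locateP m_nil m_split (size w) u01; rewrite uw in_itv.
rewrite !in_itv/= => /[dup] /(locate_uniq m_ge0 m_split) uw /andP[h1 h2].
have u01 : 0 <= u < 1.
  rewrite (le_trans (left_end_ge0 m_ge0 w) h1)/=.
  exact: lt_le_trans h2 (left_end_le1 m_ge0 m_nil m_split w).
by rewrite /address u01.
Qed.

Lemma measurable_address w : measurable [set u | address u (size w) = w].
Proof.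
have m01 : measurable (`[0, 1[%classic : set R) by [].
rewrite -(setUIDK  [set u | address u (size w) = w] `[0, 1[) .
rewrite address_in; apply: measurableU => //.
have [w0|w0] := pselect (locate m 0 (size w) = w).
  rewrite (_ : _ `\` _ = ~` `[0, 1[); first exact: measurableC.
  apply/seteqP; split => u /=; first by case.
  by rewrite in_itv/= => /negP u01; split; [rewrite /address (negbTE u01)|exact/negP].
rewrite (_ : _ `\` _ = set0)//; apply/seteqP; split => // u [/= + ] .
by rewrite in_itv/= /address => + /negP/negbTE u01; rewrite u01.
Qed.

Lemma unif01_address w : fine (@unif01 R [set u | address u (size w) = w]) = m w.
Proof.
rewrite /unif01 /mrestr address_in lebesgue_measure_itv /= lte_fin.
have := m_ge0 w; rewrite le_eqVlt => /predU1P[<-|m0]; first by rewrite addr0 ltxx.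
by rewrite ltrDl m0 /= addrAC subrr add0r.
Qed.

End uniform_digits.

Lemma energy_distribution d d' (T : measurableType d) (T' : measurableType d')
  (R : realType) (P : probability T R) (X : {mfun T >-> T'}) (K : set T')
  (k : T' * T' -> \bar R) : measurable K -> (forall u, K (X u)) ->
  measurable_fun (K `*` K) k -> (forall x y, K x -> K y -> 0 <= k (x, y))%E ->
  energy K k (distribution P X) = energy setT (fun z => k (X z.1, X z.2)) P.
Proof.
move=> mK KX mk k0; have mKK : measurable (K `*` K) by exact: measurableX.
set k' := k \_ (K `*` K).
have k'0 z : (0 <= k' z)%E.
  by rewrite /k' patchE; case: ifPn => //; case: z => x y; rewrite inE => -[]; exact: k0.
have mk' : measurable_fun setT k' by exact/(measurable_restrictT _ mKK).
have kX u v : k (X u, X v) = k' (X u, X v).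
  by rewrite /k' patchE mem_set//; split; exact: KX.
have mX : measurable_fun setT X by [].
rewrite /energy integral_mkcond -/k' fubini_tonelli1//.
rewrite (ge0_integral_pushforward mX)//; last first.
- by move=> x _; apply: integral_ge0.
- exact: measurable_fun_fubini_tonelli_F.
rewrite setXTT fubini_tonelli1; first last.
- by move=> z; exact: k0.
- under eq_fun do rewrite kX.
  apply: (measurableT_comp mk'); apply/measurable_fun_pairP; split => /=.
    exact: (measurableT_comp mX measurable_fst).
  exact: (measurableT_comp mX measurable_snd).
rewrite preimage_setT; apply: eq_integral => u _ /=; rewrite /fubini_F.
rewrite (ge0_integral_pushforward mX)//.
  by apply: eq_integral => v _; rewrite /= kX.
by apply: (measurableT_comp mk'); exact: measurable_pair1.
Qed.

Lemma cell_address_le (T : Type) (B : nat -> set T) (R : realType) (m : seq bool -> R)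
  u k l : (k <= l)%N -> cell B (address m u l) `<=` cell B (address m u k).
Proof.
elim: l => [|l IH]; first by rewrite leqn0 => /eqP ->.
rewrite leq_eqVlt => /predU1P[->//|]; rewrite ltnS => /IH kl.
by apply: subset_trans kl; rewrite {1}/address /= cell_cons; exact: subIsetl.
Qed.

Section limit_map.
Context (R : realType) (n : nat) (K : set 'rV[R]_n) (cK : compact K).
Variables (B : nat -> set 'rV[R]_n).
Variable m : seq bool -> R.
Hypotheses (m_ge0 : forall w, 0 <= m w) (m_nil : m [::] = 1)
  (m_split : forall w, m w = m (false :: w) + m (true :: w)).
Hypothesis m_cell : forall w, 0 < m w -> exists2 x, K x & cell B w x.

Definition mesh_le k (e : R) := forall x y, K x -> K y ->
  code B x k = code B y k -> ball x e y.

(** [rep] picks a point of K in every cell that meets K. The representatives of the successive cells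
    addressed by u have a cluster point in K by compactness; since these cells are nested, it is as
    close to each representative as the mesh allows. *)
Lemma limit_map : exists (rep : seq bool -> 'rV[R]_n) (X : R -> 'rV[R]_n),
  [/\ forall w, K (rep w),
      forall x k, K x -> cell B (code B x k) (rep (code B x k)),
      forall u, K (X u) &
      forall u k e, 0 < e -> mesh_le k e -> ball (rep (address m u k)) (e + e) (X u)].
Proof.
have [x0 Kx0 _] : exists2 x, K x & cell B [::] x.
  by apply: m_cell; rewrite m_nil.
have /choice[rep Hrep] : forall w, exists y : 'rV[R]_n,
    K y /\ ((exists2 x, K x & cell B w x) -> cell B w y).
  move=> w; have [[x Kx wx]|h] := pselect (exists2 x, K x & cell B w x).
    by exists x; split.
  by exists x0; split.
have repA u k : cell B (address m u k) (rep (address m u k)).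
  by apply: (Hrep _).2; apply: m_cell; exact: address_gt0.
have /choice[X HX] : forall u : R, exists y : 'rV[R]_n, K y /\
    cluster ((fun k => rep (address m u k)) @ \oo) y.
  move=> u.
  have [|y [Ky cy]] := cK (F := (fun k => rep (address m u k)) @ \oo) _ _.
    by exists 0%N => // k _; exact: (Hrep _).1.
  by exists y.
exists rep, X; split => [w|x k Kx|u|u k e e0 mk].
- exact: (Hrep w).1.
- by apply: (Hrep _).2; exists x => //; exact: cell_code.
- exact: (HX u).1.
have [KX cX] := HX u.
have [|y [[l /= kl <-] yX]] := cX [set rep (address m u l) | l in [set l | (k <= l)%N]]
  _ _ (nbhsx_ballx (X u) e e0).
  by exists k => // l /= kl; exists l.
apply: (@ball_triangle _ _ (rep (address m u l))); last exact: ball_sym.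
apply: mk; [exact: (Hrep _).1|exact: (Hrep _).1|].
have := repA u k; have := cell_address_le kl (repA u l).
by rewrite /cell /= size_address => -> ->.
Qed.

Lemma measurable_address_preim (A : set (seq bool)) k :
  measurable [set u : R | A (address m u k)].
Proof.
rewrite (_ : [set u | _] = \bigcup_(w in [set w : k.-tuple bool | A w])
   [set u | address m u (size w) = w]).
  apply: fin_bigcup_measurable; first exact: finite_finset.
  by move=> w _; exact: measurable_address.
apply/seteqP; split => u /=.
  have /eqP sz := size_address m u k.
  by move=> Au; exists (Tuple sz) => //=; rewrite size_address.
by case=> w /= Aw; rewrite size_tuple => ->.
Qed.

(** X lies in an open V exactly when, at some scale 1/(i+1), the whole ball of radius 2/(i+1) around
    a representative lies in V; this condition depends on finitely many digits of u. *)
Lemma measurable_limit_map (rep : seq bool -> 'rV[R]_n) (X : R -> 'rV[R]_n) :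
  (forall e, 0 < e -> exists k, mesh_le k e) ->
  (forall u k e, 0 < e -> mesh_le k e -> ball (rep (address m u k)) (e + e) (X u)) ->
  measurable_fun setT (X : measurableTypeR R -> borelRn R n).
Proof.
move=> HN HX.
apply: (@measurability _ _ (measurableTypeR R) (borelRn R n) setT X (@open 'rV[R]_n)) => //.
move=> _ [V oV <-]; rewrite setTI.
have /choice[N NP] : forall i : nat, exists k, mesh_le k (i.+1%:R^-1).
  by move=> i; apply: HN; rewrite invr_gt0.
rewrite (_ : X @^-1` V = \bigcup_i [set u | (rep @^-1`
   [set y | ball y (i.+1%:R^-1 + i.+1%:R^-1) `<=` V]) (address m u (N i))]).
  by apply: bigcup_measurable => i _; exact: measurable_address_preim.
apply/seteqP; split => u /=; last first.
  by case=> i _ /=; apply; apply: HX.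
rewrite openE in oV => /oV /nbhs_ballP[e /= e0 eV].
have e4 : 0 < e / 4 by rewrite divr_gt0.
have [i _ Hi] := near_infty_natSinv_lt (PosNum e4).
have {}Hi : (i.+1%:R^-1 : R) < e / 4 by apply: (Hi i) => /=.
exists i => //= y ry; apply: eV.
have i0 : 0 < (i.+1%:R^-1 : R) by rewrite invr_gt0.
have := HX u (N i) _ i0 (NP i) => /ball_sym /ball_triangle /(_ ry).
apply: le_ball; have a4 (a b : R) : a < b / 4 -> a + a + (a + a) <= b by lra.
exact: a4.
Qed.

End limit_map.

Definition code_tuple T (B : nat -> set T) k (x : T) : k.-tuple bool :=
  Tuple (introT eqP (size_code B x k)).

Definition address_tuple (R : realType) (m : seq bool -> R) k (u : R) : k.-tuple bool :=
  Tuple (introT eqP (size_address m u k)).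

Lemma code_tuple_preim T (B : nat -> set T) k (w : k.-tuple bool) :
  code_tuple B k @^-1` [set w] = cell B w.
Proof.
apply/seteqP; split => x /=; rewrite /cell/= size_tuple; first by move=> <-.
by move=> xw; apply: val_inj.
Qed.

Lemma address_tuple_preim (R : realType) (m : seq bool -> R) k (w : k.-tuple bool) :
  address_tuple m k @^-1` [set w] = [set u | address m u (size w) = w].
Proof.
apply/seteqP; split => u /=; rewrite size_tuple; first by move=> <-.
by move=> xw; apply: val_inj.
Qed.

Definition unif_cont_on (R : realType) (n : nat) (K : set 'rV[R]_n)
    (h : 'rV[R]_n * 'rV[R]_n -> R) := forall e : R, 0 < e ->
  exists2 r : R, 0 < r & forall x y x' y', K x -> K y -> K x' -> K y' ->
    ball x r x' -> ball y r y' -> `|h (x, y) - h (x', y')| <= e.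

(** Compactness of the set of probability measures on K, in ultrafilter form. Only upper bounds
    of energies are transferred; this yields convergence of integrals, by applying it to a function
    and to its opposite. At mesh r/2 both energies are within e/2 of the same Riemann sum, evaluated
    at the cell masses of mu i and at their limits. *)
Lemma prob_ultra_limit (R : realType) (n : nat) (K : set 'rV[R]_n) (cK : compact K)
  (I : Type) (U : set_system I) (mu : I -> probability (borelRn R n) R) :
  UltraFilter U -> (\forall i \near U, mu i K = 1%E) ->
  exists2 nu : probability (borelRn R n) R, nu K = 1%E &
  forall h : borelRn R n * borelRn R n -> R,
    measurable_fun ((K : set (borelRn R n)) `*` (K : set (borelRn R n))) h ->
    (forall x y, K x -> K y -> 0 <= h (x, y)) -> unif_cont_on K h ->
    forall C : R,
      (\forall i \near U, energy (K : set (borelRn R n)) (EFin \o h) (mu i) <= C%:E)%E ->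
      (energy (K : set (borelRn R n)) (EFin \o h) nu <= C%:E)%E.
Proof.
move=> UU muK; have mK := compact_borel cK.
have [B [oB HB]] := compact_mesh cK.
have HN (e : R) : 0 < e -> exists k, mesh_le K B k e.
  move=> /HB[N HN]; exists N => x y Kx Ky /code_eqP; exact: HN.
have mB (j : nat) : measurable (B j : set (borelRn R n)) by exact: open_borel.
have [m [mlim m0 m1 ms]] := limit_mass mB UU mu.
(* A cell that misses K has mass 0 for all the measures that are carried by K. *)
have mcell w : 0 < m w -> exists2 x, K x & cell B w x.
  move=> mw; have [//|nE] := pselect (exists2 x, K x & cell B w x).
  have mC : measurable (cell B w : set (borelRn R n)) by exact: measurable_cell.
  have : \forall i \near U, fine (mu i (cell B w)) = 0.
    apply: filterS muK => i muiK.
    rewrite (_ : mu i (cell B w) = 0)%E//; apply/eqP; rewrite -measure_le0.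
    rewrite (_ : 0%E = mu i (~` K)); last first.
      by have -> := probability_setC (mu i) mK; rewrite muiK subee.
    apply: le_measure; rewrite ?inE//; first exact: measurableC.
    by move=> x wx Kx; apply: nE; exists x.
  move=> f0; suff : m w = 0 by move=> mw0; rewrite mw0 ltxx in mw.
  apply: (cvg_unique _ (mlim w)) => //.
  by apply: cvg_near_cst; apply: filterS f0 => i /= ->.
have [rep [X [Krep coderep KX HX]]] := limit_map cK m1 ms mcell.
have mX := measurable_limit_map m0 m1 ms HN HX.
pose X' : {mfun (measurableTypeR R) >-> borelRn R n} :=
  HB.pack (X : measurableTypeR R -> borelRn R n)
    (isMeasurableFun.Build _ _ (measurableTypeR R) (borelRn R n)
       (X : measurableTypeR R -> borelRn R n) mX).
exists (distribution (@unif01 R) X').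
  transitivity (@unif01 R setT); last exact: unif01T.
  by congr (@unif01 R _); apply/seteqP; split => // u _; exact: KX.
move=> h mh h0 hu C hC; apply/lee_addgt0Pr => e e0.
have e2 : 0 < e / 2 by rewrite divr_gt0.
have [r r0 hr] := hu _ e2.
have r2 : 0 < r / 2 by rewrite divr_gt0.
have [k kP] := HN _ r2.
pose G (w v : k.-tuple bool) := h (rep w, rep v).
have G0 w v : 0 <= G w v by exact: h0.
pose S (f : seq bool -> R) :=
  \sum_(w : k.-tuple bool) (\sum_(v : k.-tuple bool) G w v * f v) * f w.
have mEh : measurable_fun ((K : set (borelRn R n)) `*` (K : set (borelRn R n))) (EFin \o h).
  exact/measurable_EFinP.
have nearG x y : K x -> K y ->
    `|h (x, y) - G (code_tuple B k x) (code_tuple B k y)| <= e / 2.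
  move=> Kx Ky; apply: hr => //.
    apply: (@le_ball _ _ _ (r / 2)); first lra.
    apply: kP => //; have := coderep x k Kx.
    by rewrite /cell /= size_code.
  apply: (@le_ball _ _ _ (r / 2)); first lra.
  apply: kP => //; have := coderep y k Ky.
  by rewrite /cell /= size_code.
have nearX u v :
    `|h (X u, X v) - G (address_tuple m k u) (address_tuple m k v)| <= e / 2.
  by rewrite distrC; apply: hr => //; rewrite (splitr r); exact: HX.
have Smu i : mu i K = 1%E ->
    energy (K : set (borelRn R n))
      (fun z => (G (code_tuple B k z.1) (code_tuple B k z.2))%:E) (mu i) =
    (S (fun w => fine (mu i (cell B w))))%:E.
  move=> muiK; rewrite energy_finite_valued//; last first.
    by move=> w; rewrite code_tuple_preim; exact: measurable_cell.
  congr (_%:E); apply: eq_bigr => w _; rewrite code_tuple_preim; congr (_ * _).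
  by apply: eq_bigr => v _; rewrite code_tuple_preim.
have Snu : energy (setT : set (measurableTypeR R))
    (fun z => (G (address_tuple m k z.1) (address_tuple m k z.2))%:E) (@unif01 R) = (S m)%:E.
  rewrite energy_finite_valued//; first last.
  - exact: unif01T.
  - by move=> w; rewrite address_tuple_preim; exact: measurable_address.
  congr (_%:E); apply: eq_bigr => w _; rewrite address_tuple_preim unif01_address//; congr (_ * _).
  by apply: eq_bigr => v _; rewrite address_tuple_preim unif01_address.
have cvg_sumR (J : finType) (f : J -> I -> R) (l : J -> R) :
    (forall j, f j i @[i --> U] --> l j) ->
    \sum_(j : J) f j i @[i --> U] --> \sum_(j : J) l j.
  by move=> fl; apply: cvg_big => [|j _]; [exact: add_continuous|exact: fl].
have mG : measurable_fun ((K : set (borelRn R n)) `*` (K : set (borelRn R n)))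
    (fun z => (G (code_tuple B k z.1) (code_tuple B k z.2))%:E).
  apply: measurable_funS (measurable_finite_valued2 G _) => // w.
  by rewrite code_tuple_preim; exact: measurable_cell.
have SmC : S m <= C + e / 2.
  have Slim : (S (fun w => fine (mu i (cell B w)))) @[i --> U] --> S m.
    apply: (cvg_sumR) => w; apply: cvgM => //.
    by apply: cvg_sumR => v; apply: cvgM => //; exact: cvg_cst.
  apply: (cvgr_to_le Slim); apply: filterS2 muK hC => i muiK hCi.
  rewrite -lee_fin -Smu// EFinD.
  apply: le_trans (leeD2r _ hCi).
  apply: energy_le_addc => //.
  - by move=> x y _ _; rewrite lee_fin.
  - exact: ltW.
  - move=> x y Kx Ky; rewrite /= -EFinD lee_fin.
    by have := nearG x y Kx Ky; rewrite ler_norml => /andP[]; lra.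
rewrite energy_distribution//.
apply: (@le_trans _ _ (S m + e / 2)%:E); last first.
  by rewrite -EFinD lee_fin; lra.
rewrite EFinD -Snu; apply: energy_le_addc => //.
- exact: unif01T.
- rewrite setXTT.
  apply: (measurable_comp (F := (K : set (borelRn R n)) `*` (K : set (borelRn R n)))
    (f := EFin \o h)
    (g := fun z : measurableTypeR R * measurableTypeR R => (X' z.1, X' z.2))) => //.
  + exact: measurableX.
  + by move=> _ [z _ <-]; split; exact: KX.
  + apply/measurable_fun_pairP; split => /=.
      exact: (measurableT_comp mX measurable_fst).
    exact: (measurableT_comp mX measurable_snd).
- rewrite setXTT; apply: measurable_finite_valued2 => w.
  by rewrite address_tuple_preim; exact: measurable_address.
- by move=> u v _ _; rewrite lee_fin; apply: h0; exact: KX.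
- by move=> u v _ _; rewrite lee_fin.
- exact: ltW.
- move=> u v _ _; rewrite /= -EFinD lee_fin.
  by have := nearX u v; rewrite ler_norml => /andP[]; lra.
Qed.

(** * The unified kernel *)

Section slope.
Context (R : realType).
Implicit Types (p q a b l t : R).

(** With a = - ln t this is (t^(-p) - 1) / p, extended by - ln t at p = 0. *)
Definition exp_slope p a : R := if p == 0 then a else (expR (p * a) - 1) / p.

(** Convexity of the exponential between 0 and a. Both h1 and h2 bound expR at one end from below by
    the tangent at l * a. *)
Lemma expR_le_scale l a : 0 <= l <= 1 -> expR (l * a) <= l * expR a + (1 - l).
Proof.
move=> /andP[l0 l1]; have E := expR_gt0 (l * a).
have h1 : expR (l * a) * (1 + (1 - l) * a) <= expR a.
  have -> : expR a = expR (l * a) * expR ((1 - l) * a).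
    by rewrite -expRD; congr expR; ring.
  by rewrite ler_pM2l// expR_ge1Dx.
have h2 : expR (l * a) * (1 - l * a) <= 1.
  by rewrite -[leRHS](expRxMexpNx_1 (l * a)) ler_pM2l// expR_ge1Dx.
nra.
Qed.

Lemma exp_slope_le0 p a : p <= 0 -> exp_slope p a <= a.
Proof.
rewrite /exp_slope le_eqVlt => /predU1P[->|p0]; first by rewrite eqxx.
rewrite lt_eqF// ler_ndivrMr// mulrC.
by have := expR_ge1Dx (p * a); lra.
Qed.

Lemma exp_slope_ge0 p a : 0 <= p -> a <= exp_slope p a.
Proof.
rewrite /exp_slope le_eqVlt => /predU1P[<-|p0]; first by rewrite eqxx.
rewrite gt_eqF// ler_pdivlMr// mulrC.
by have := expR_ge1Dx (p * a); lra.
Qed.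

Lemma exp_slope_homo a : {homo exp_slope ^~ a : p q / p <= q}.
Proof.
move=> p q pq; have [p0|p0] := leP p 0; have [q0|q0] := leP 0 q.
- exact: le_trans (exp_slope_le0 a p0) (exp_slope_ge0 a q0).
- have p0' : p < 0 by exact: le_lt_trans q0.
  rewrite /exp_slope !lt_eqF// ler_ndivlMr// mulrAC ler_ndivlMr//.
  have l01 : 0 <= q / p <= 1.
    by rewrite ler_ndivlMr// mul0r ltW//= ler_ndivrMr// mul1r.
  have := expR_le_scale (p * a) l01.
  rewrite mulrA mulfVK ?lt_eqF// => h.
  have : (expR (q * a) - 1) * - p <= (q / p * (expR (p * a) - 1)) * - p.
    by apply: ler_wpM2r; [rewrite oppr_ge0 ltW|lra].
  have -> : q / p * (expR (p * a) - 1) * - p = - (q * (expR (p * a) - 1)).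
    by field; rewrite lt_eqF.
  lra.
- have q0' : 0 < q by exact: lt_le_trans pq.
  rewrite /exp_slope !gt_eqF// ler_pdivrMr// mulrAC ler_pdivlMr//.
  have l01 : 0 <= p / q <= 1.
    by rewrite ler_pdivrMr// mul1r pq andbT divr_ge0// ltW.
  have := expR_le_scale (q * a) l01.
  rewrite mulrA mulfVK ?gt_eqF// => h.
  have : (expR (p * a) - 1) * q <= (p / q * (expR (q * a) - 1)) * q.
    by apply: ler_wpM2r; [rewrite ltW|lra].
  have -> : p / q * (expR (q * a) - 1) * q = p * (expR (q * a) - 1).
    by field; rewrite gt_eqF.
  lra.
- lra.
Qed.

Lemma exp_slope_homor p : {homo exp_slope p : a b / a <= b}.
Proof.
move=> a b ab; rewrite /exp_slope; have [//|p0] := eqVneq p 0.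
have [p_gt0|p_le0] := ltP 0 p.
  by rewrite ler_pM2r ?invr_gt0// lerD2r ler_expR ler_pM2l.
have {}p_lt0 : p < 0 by rewrite lt_neqAle p0.
by rewrite ler_nM2r ?invr_lt0// lerD2r ler_expR ler_nM2l.
Qed.

(** At q = 0 the slope lies between a and a * expR (p * a), whence the squeeze. *)
Lemma exp_slope_cvg a q : exp_slope p a @[p --> q] --> exp_slope q a.
Proof.
have cE : expR (p * a) @[p --> q] --> expR (q * a).
  apply: continuous_cvg; first exact: continuous_expR.
  by apply: cvgM; [exact: cvg_id|exact: cvg_cst].
have [q0|q0] := eqVneq q 0; last first.
  rewrite {2}/exp_slope (negbTE q0).
  have : (expR (p * a) - 1) / p @[p --> q] --> (expR (q * a) - 1) / q.
    apply: cvgM; first by apply: cvgB => //; exact: cvg_cst.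
    by apply: cvgV.
  have nq : nbhs q [set p : R | p != 0].
    by apply: open_nbhs_nbhs; split; [exact: open_neq|exact: q0].
  apply: cvg_trans; apply: near_eq_cvg; near=> p.
  rewrite /exp_slope ifF//; apply/negbTE; near: p.
  exact: nq.
rewrite q0 {2}/exp_slope eqxx.
rewrite q0 mul0r expR0 in cE.
have cA (s : R) : a + s * (`|a| * `|expR (p * a) - 1|) @[p --> 0] --> a.
  rewrite -[X in _ --> X](_ : a + s * (`|a| * `|1 - 1|) = a); last first.
    by rewrite subrr normr0 !mulr0 addr0.
  apply: cvgD; first exact: cvg_cst.
  apply: cvgM; first exact: cvg_cst.
  apply: cvgM; first exact: cvg_cst.
  by apply: cvg_norm; apply: cvgB => //; exact: cvg_cst.
apply: squeeze_cvgr (cA (-1)) (cA 1); near=> p.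
have E0 := expR_gt0 (p * a).
have h : p * a * expR (p * a) >= expR (p * a) - 1.
  have := expR_ge1Dx (- (p * a)).
  rewrite -(ler_pM2l E0) expRxMexpNx_1; lra.
have bnd : `|exp_slope p a - a| <= `|a * (expR (p * a) - 1)|.
  have [p0|p0] := leP p 0.
    have h1 := exp_slope_le0 a p0.
    have h2 : a * expR (p * a) <= exp_slope p a.
      rewrite /exp_slope; case: eqVneq => [->|pN]; first by rewrite mul0r expR0 mulr1.
      have {}p0 : p < 0 by rewrite lt_neqAle pN.
      by rewrite ler_ndivlMr//; lra.
    by rewrite !ler0_norm; lra.
  have h1 := exp_slope_ge0 a (ltW p0).
  have h2 : exp_slope p a <= a * expR (p * a).
    by rewrite /exp_slope gt_eqF// ler_pdivrMr//; lra.
  by rewrite !ger0_norm; lra.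
rewrite normrM in bnd.
move: bnd; rewrite ler_norml => /andP[]; rewrite mulN1r mul1r => *; apply/andP; split; lra.
Unshelve. all: by end_near.
Qed.

End slope.

(** * Uniform continuity and the Euclidean distance *)

(** Counterexamples z_k, z'_k at scale 1/(k+1) would cluster at a point where h is not continuous. *)
Lemma heine_cantor (R : realType) (T : pseudoMetricType R) (A : set T) (h : T -> R) :
  compact A -> {within A, continuous h} ->
  forall e : R, 0 < e -> exists2 r : R, 0 < r &
    forall z z', A z -> A z' -> ball z r z' -> `|h z - h z'| <= e.
Proof.
move=> cA ch e e0; apply: contrapT => nh.
have nk (k : nat) : exists zz : T * T, [/\ A zz.1, A zz.2, ball zz.1 k.+1%:R^-1 zz.2 &
    e < `|h zz.1 - h zz.2|].
  apply: contrapT => nk; apply: nh; exists k.+1%:R^-1; first by rewrite invr_gt0.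
  move=> z z' Az Az' zz'; rewrite leNgt; apply/negP => zze.
  by apply: nk; exists (z, z').
have {nh nk} [s sP] := choice nk.
have [|c [Ac cc]] := cA ((fun k => (s k).1) @ \oo) _ _.
  by exists 0%N => // k _; have [] := sP k.
have e2 : 0 < e / 2 by rewrite divr_gt0.
have : nbhs c [set z | A z -> `|h c - h z| < e / 2].
  have := ch c; rewrite /continuous_at => /cvgrPdist_lt /(_ _ e2).
  by rewrite {1}/nbhs /= -nbhs_subspace_in.
move=> /nbhs_ballP[d /= d0 dP].
have d2 : 0 < d / 2 by rewrite divr_gt0.
have [N _ HN] := near_infty_natSinv_lt (PosNum d2).
have [|_ [[k /= Nk <-] cz]] := cc [set (s k).1 | k in [set k | (N <= k)%N]]
  _ _ (nbhsx_ballx c _ d2).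
  by exists N => // k /= Nk; exists k.
have [Az Az' zz' hh] := sP k.
have dz : ball c d (s k).1 by apply: le_ball cz; lra.
have dz' : ball c d (s k).2.
  rewrite (splitr d); apply: ball_triangle cz _.
  by apply: le_ball zz'; apply: ltW; exact: HN.
have := dP _ dz Az; have := dP _ dz' Az'; move: hh.
have := ler_distD (h c) (h (s k).1) (h (s k).2).
rewrite (distrC _ (h c)); lra.
Qed.

Lemma measurable_within_continuous (R : realType) (n : nat) (K : set 'rV[R]_n) (f : 'rV[R]_n -> R) :
  compact K -> {within K, continuous f} ->
  measurable_fun (K : set (borelRn R n)) (f : borelRn R n -> R).
Proof.
move=> cK /continuousP cf.
have mK := compact_borel cK.
apply: (measurability _ (RGenOpens.measurableE R)).
move=> _ [_ [a [b ->] <-]].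
have oV : open (f @^-1` `]a, b[ : set (subspace K)) by exact/cf/interval_open.
have [V {}oV VE] := (open_subspaceP K (f @^-1` `]a, b[)).1 oV.
rewrite setIC -VE; apply: measurableI => //; exact: open_borel.
Qed.

Lemma measurable_coord (R : realType) (n : nat) (i : 'I_n) :
  measurable_fun setT (fun x : borelRn R n => (x : 'rV[R]_n) ord0 i).
Proof.
apply: (measurability _ (RGenOpens.measurableE R)).
move=> _ [_ [a [b ->] <-]]; rewrite setTI; apply: open_borel.
have : open (`]a, b[%classic : set R) by exact: interval_open.
by apply: open_comp => x _; exact: coord_continuous.
Qed.

(** The Euclidean distance on pairs of points that carry the Borel structure. *)
Definition edist (R : realType) (n : nat) (z : borelRn R n * borelRn R n) : R :=
  enorm ((z.1 : 'rV[R]_n) - z.2).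

Lemma measurable_edist (R : realType) (n : nat) : measurable_fun setT (@edist R n).
Proof.
apply: (measurableT_comp (f := @Num.sqrt R)).
  apply: continuous_measurable_fun; exact: sqrt_continuous.
apply: measurable_sum => i; apply: measurable_funX.
rewrite (_ : (fun x => _) = (fun z : borelRn R n * borelRn R n =>
    (z.1 : 'rV[R]_n) ord0 i - (z.2 : 'rV[R]_n) ord0 i)).
  by apply: measurable_funB; apply: measurableT_comp (measurable_coord i) _.
by apply/funext => z; rewrite !mxE.
Qed.

Lemma continuous_edist (R : realType) (n : nat) :
  continuous (fun z : 'rV[R]_n * 'rV[R]_n => enorm (z.1 - z.2)).
Proof.
move=> z; apply: (continuous_comp
  (f := fun z : 'rV[R]_n * 'rV[R]_n => \sum_(i < n) (z.1 - z.2) ord0 i ^+ 2)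
  (g := @Num.sqrt R)); last exact: sqrt_continuous.
apply: cvg_big => [|i _]; first exact: add_continuous.
apply: (continuous_comp (f := fun z : 'rV[R]_n * 'rV[R]_n => (z.1 - z.2) ord0 i)
  (g := fun x : R => x ^+ 2)); last exact: exprn_continuous.
apply: (continuous_comp (f := fun z : 'rV[R]_n * 'rV[R]_n => z.1 - z.2)
  (g := fun x : 'rV[R]_n => x ord0 i)); last exact: coord_continuous.
exact: sub_continuous.
Qed.

Lemma edist_bounded (R : realType) (n : nat) (K : set 'rV[R]_n) : compact K ->
  exists D : R, forall x y, K x -> K y -> enorm (x - y) <= D.
Proof.
move=> cK.
have cKK := compact_setX cK cK.
have : compact [set enorm (z.1 - z.2) | z in K `*` K].
  apply: continuous_compact cKK; apply: continuous_subspaceT.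
  exact: continuous_edist.
move=> /compact_bounded[M [_ HM]]; exists (M + 1) => x y Kx Ky.
apply: le_trans (ler_norm _) _; apply: HM; first by rewrite ltrDl.
by exists (x, y).
Qed.

Lemma enorm_ge0 (R : realType) (n : nat) (x : 'rV[R]_n) : 0 <= enorm x.
Proof. exact: sqrtr_ge0. Qed.

Lemma enorm_eq0 (R : realType) (n : nat) (x : 'rV[R]_n) : (enorm x == 0) = (x == 0).
Proof.
rewrite sqrtr_eq0; apply/idP/eqP => [h|->]; last first.
  by rewrite big1// => i _; rewrite mxE expr0n.
apply/rowP => i; rewrite mxE; apply/eqP; rewrite -sqrf_eq0 eq_le sqr_ge0 andbT.
by apply: le_trans h; rewrite (bigD1 i)//= lerDl sumr_ge0// => j _; exact: sqr_ge0.
Qed.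

Lemma unif_cont_on_within (R : realType) (n : nat) (K : set 'rV[R]_n) h :
  compact K -> {within K `*` K, continuous h} -> @unif_cont_on R n K h.
Proof.
move=> cK ch e e0; have [r r0 H] := heine_cantor (compact_setX cK cK) ch e0.
by exists r => // x y x' y' *; apply: H.
Qed.

Section kern.
Context (R : realType).
Implicit Types (p q t : R).

(** The value at t = 0 is the limit as t decreases to 0. *)
Definition kern p t : \bar R :=
  if 0 < t then (exp_slope p (- ln t))%:E
  else if 0 <= p then +oo%E else (- p^-1)%:E.

Lemma kern_homo t : {homo kern ^~ t : p q / p <= q >-> (p <= q)%E}.
Proof.
move=> p q pq; rewrite /kern; case: ifPn => [_|_].
  by rewrite lee_fin exp_slope_homo.
case: (leP 0 q) => q0; first by case: ifPn => _; rewrite ?leey.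
have p0 : p < 0 := le_lt_trans pq q0.
by rewrite (lt_geF p0) lee_fin lerN2 lef_nV2 ?negrE.
Qed.

(** Monotonicity in p reduces the bound to p = -2, where kern (-2) t = (1 - t^2) / 2. *)
Lemma kern_ge (D : R) p t : -2 <= p -> 0 <= t <= D -> (((1 - D ^+ 2) / 2)%:E <= kern p t)%E.
Proof.
move=> p2 /andP[t0 tD]; apply: le_trans (kern_homo t p2).
have D0 : 0 <= D by exact: le_trans tD.
rewrite /kern; have N20 : (-2 : R) < 0 by rewrite oppr_lt0.
case: ifPn => t_gt0; last first.
  rewrite (lt_geF N20) lee_fin; have := sqr_ge0 D; rewrite invrN opprK; lra.
rewrite lee_fin /exp_slope lt_eqF// mulrNN expRM_natl.
rewrite ?lnK ?posrE//.
have : t ^+ 2 <= D ^+ 2 by rewrite ler_sqr.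
lra.
Qed.

Lemma measurable_kern p : measurable_fun setT (kern p).
Proof.
rewrite /kern; apply: measurable_fun_ifT => //.
  exact: measurable_fun_ltr.
apply/measurable_EFinP; rewrite /exp_slope; case: eqVneq => _.
  by apply: measurableT_comp => //; exact: measurable_ln.
apply: measurable_funM => //; apply: measurable_funB => //.
apply: measurableT_comp => //; apply: measurable_funM => //.
by apply: measurableT_comp => //; exact: measurable_ln.
Qed.

Definition trunc_kern p (d : R) t : R := exp_slope p (- ln (Num.max t d)).

Lemma trunc_kern_le p d t : 0 < d -> 0 <= t -> ((trunc_kern p d t)%:E <= kern p t)%E.
Proof.
move=> d0; rewrite [0 <= t]le_eqVlt => /predU1P[<-|t0].
  rewrite /trunc_kern max_r ?(ltW d0)// /kern ltxx; case: (leP 0 p) => p0; first by rewrite leey.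
  rewrite lee_fin /exp_slope lt_eqF//.
  rewrite ler_ndivrMr// mulNr mulVf ?lt_eqF//.
  by have := expR_gt0 (p * - ln d); lra.
rewrite /kern t0 lee_fin; apply: exp_slope_homor; rewrite lerN2.
by rewrite ler_ln ?posrE ?lt_max ?t0 ?le_max ?lexx.
Qed.

Lemma trunc_kern_homo p t d d' : 0 < d -> d <= d' -> trunc_kern p d' t <= trunc_kern p d t.
Proof.
move=> d0 dd'; apply: exp_slope_homor; rewrite lerN2.
have d'0 : 0 < d' by exact: lt_le_trans dd'.
by rewrite ler_ln ?posrE ?lt_max ?d0 ?d'0 ?orbT// ge_max le_max lexx /= le_max dd' orbT.
Qed.

Lemma continuous_trunc_kern p d : 0 < d -> continuous (trunc_kern p d).
Proof.
move=> d0 t; have m0 : 0 < Num.max t d by rewrite lt_max d0 orbT.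
have cl : - ln (Num.max x d) @[x --> t] --> - ln (Num.max t d).
  apply: cvgN; apply: continuous_cvg; first exact: continuous_ln.
  under eq_fun do rewrite maxr_absE; rewrite maxr_absE.
  have cd : cst d x @[x --> t] --> d by exact: cvg_cst.
  apply: cvgM; last exact: cvg_cst.
  by apply: cvgD; [exact: cvgD|apply: cvg_norm; exact: cvgB].
rewrite /continuous_at /trunc_kern /exp_slope; case: eqVneq => _ //.
apply: cvgM; last exact: cvg_cst.
apply: cvgB; last exact: cvg_cst.
apply: continuous_cvg; first exact: continuous_expR.
by apply: cvgM => //; exact: cvg_cst.
Qed.

Lemma natSinv_lt (e : R) : 0 < e -> exists m : nat, (m.+1%:R^-1 : R) < e.
Proof.
move=> e0; have [m _ Hm] := near_infty_natSinv_lt (PosNum e0).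
by exists m; exact: (Hm m (leqnn m)).
Qed.

Lemma neg_ln_unbounded (A : R) : exists m : nat, A < - ln (m.+1%:R^-1 : R).
Proof.
have [m Hm] := natSinv_lt (expR_gt0 (- A)); exists m.
rewrite ltrNr -ltr_expR lnK// posrE invr_gt0; exact: ltr0Sn.
Qed.

(** It suffices to reach every real below x, whether x is finite or not. *)
Lemma ereal_sup_reach (S : \bar R) (x : \bar R) :
  (forall a : R, (a%:E < x)%E -> (a%:E <= S)%E) -> (x <= S)%E.
Proof.
case: x => [x||] H; last exact: leNye.
  apply/lee_subgt0Pr => e e0; rewrite -EFinB; apply: H.
  by rewrite lte_fin ltrBlDr ltrDl.
by rewrite leye_eq; apply/eqP/eqyP => A A0; apply: H; rewrite ltry.
Qed.

(** Only t = 0 needs an argument. For 0 <= p the truncated values dominate - ln (1/(m+1)); for p < 0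
    the value a < - 1/p is reached as soon as expR (p * - ln (1/(m+1))) <= 1 + a * p. *)
Lemma kern_sup_trunc p t : 0 <= t ->
  (kern p t <= ereal_sup (range (fun m : nat => (trunc_kern p m.+1%:R^-1 t)%:E)))%E.
Proof.
move=> t0; apply: ereal_sup_reach => a; rewrite /kern; case: ifPn => [t_gt0|].
  have [m Hm] := natSinv_lt t_gt0; move=> /ltW ha; apply: le_trans ha _.
  apply: ereal_sup_ubound; exists m => //.
  by rewrite /trunc_kern max_l// (ltW Hm).
rewrite -leNgt => tle0; have {t0 tle0}-> : t = 0 by apply/eqP; rewrite eq_le tle0.
have inv0 (m : nat) : (0 : R) < m.+1%:R^-1 by rewrite invr_gt0 ltr0Sn.
case: (leP 0 p) => p0 ha.
  have [m Hm] := neg_ln_unbounded a.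
  apply: (@le_trans _ _ (trunc_kern p m.+1%:R^-1 0)%:E); last by apply: ereal_sup_ubound; exists m.
  rewrite lee_fin /trunc_kern max_r ?(ltW (inv0 m))//; apply: le_trans (ltW Hm) _.
  exact: exp_slope_ge0.
rewrite lte_fin in ha.
have ap : 0 < 1 + a * p.
  move: ha; rewrite -subr_gt0 -(pmulr_lgt0 _ (_ : 0 < - p)) ?oppr_gt0//.
  by rewrite mulrBl mulrNN mulVf ?lt_eqF//; lra.
have [m Hm] := neg_ln_unbounded (ln (1 + a * p) / p).
apply: (@le_trans _ _ (trunc_kern p m.+1%:R^-1 0)%:E); last by apply: ereal_sup_ubound; exists m.
rewrite lee_fin /trunc_kern max_r ?(ltW (inv0 m))// /exp_slope lt_eqF// ler_ndivlMr//.
rewrite lerBlDr addrC -[leRHS]lnK ?posrE// ler_expR.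
by move: Hm => /ltW; rewrite ler_ndivrMr// mulrC.
Qed.

Lemma kern_sup_left q t :
  (kern q t <= ereal_sup (range (fun m : nat => kern (q - m.+1%:R^-1) t)))%E.
Proof.
have cvgq : q - m.+1%:R^-1 @[m --> \oo] --> q.
  rewrite -[X in _ --> X]subr0; apply: cvgB; first exact: cvg_cst.
  exact: cvg_harmonic.
apply: ereal_sup_reach => a; rewrite /kern; case: ifPn => t0.
  rewrite lte_fin => ha.
  have /(cvg_comp _ _ cvgq)/cvgr_gt/(_ _ ha) := @exp_slope_cvg R (- ln t) q.
  move=> [m _ /(_ m (leqnn m))] /= Hm.
  apply: (@le_trans _ _ (exp_slope (q - m.+1%:R^-1) (- ln t))%:E); first by rewrite lee_fin ltW.
  by apply: ereal_sup_ubound; exists m.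
case: (leP 0 q) => q0 ha; last first.
  rewrite lte_fin in ha.
  have : - (q - m.+1%:R^-1)^-1 @[m --> \oo] --> - q^-1.
    by apply: cvgN; apply: cvgV => //; rewrite lt_eqF.
  move=> /cvgr_gt/(_ _ ha)[m _ /(_ m (leqnn m))] /= Hm.
  apply: (@le_trans _ _ (- (q - m.+1%:R^-1)^-1)%:E); first by rewrite lee_fin ltW.
  apply: ereal_sup_ubound; exists m => //.
  by rewrite leNgt (le_lt_trans _ q0)//= gerBl invr_ge0.
move: q0; rewrite le_eqVlt => /predU1P[q0|q0].
  have a1 : 0 < `|a| + 1 by rewrite ltr_wpDl.
  have ia1 : 0 < (`|a| + 1)^-1 by rewrite invr_gt0.
  have [m Hm] := natSinv_lt ia1.
  apply: (@le_trans _ _ (m.+1%:R)%:E).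
    rewrite lee_fin; apply: le_trans (ler_norm a) _.
    move: Hm; rewrite ltf_pV2 ?posrE ?ltr0Sn//; lra.
  apply: ereal_sup_ubound; exists m => //.
  by rewrite -q0 sub0r oppr_ge0 leNgt invr_gt0 ltr0Sn /= invrN opprK invrK.
have [m Hm] := natSinv_lt q0.
apply: (@le_trans _ _ +oo%E); first by rewrite leey.
by apply: ereal_sup_ubound; exists m => //; rewrite subr_ge0 ltW.
Qed.

Lemma kern_cvg_right (u : nat -> R) q t : u @ \oo --> q -> (forall m, q <= u m) ->
  kern (u m) t @[m --> \oo] --> kern q t.
Proof.
move=> uq qu; rewrite /kern; case: ifPn => _.
  apply: cvg_EFin; first by apply: nearW.
  exact: (cvg_comp _ _ uq (@exp_slope_cvg R (- ln t) q)).
have [q0|q0] := leP 0 q.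
  by under eq_fun do rewrite (le_trans q0 (qu _)); exact: cvg_cst.
apply: (@cvg_trans _ ((- (u m)^-1)%:E @[m --> \oo])).
  apply: near_eq_cvg; have /cvgr_lt/(_ _ q0) := uq.
  by apply: filterS => m um; rewrite leNgt um.
apply: cvg_EFin; first by apply: nearW.
by apply: cvgN; apply: cvgV => //; rewrite lt_eqF.
Qed.

End kern.

(** * Equilibrium measures as minimizers of one energy *)

(** The negative part is bounded, hence of finite integral, so b can be moved across the definition
    of the integral as a difference even when the integral of f is infinite. *)
Lemma integral_bounded_belowD d (T : measurableType d) (R : realType)
  (P : probability T R) (K : set T) (f : T -> \bar R) (b : R) :
  measurable K -> P K = 1%E -> measurable_fun K f ->
  (forall x, K x -> (- b)%:E <= f x)%E -> 0 <= b ->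
  (\int[P]_(x in K) (f x + b%:E) = \int[P]_(x in K) f x + b%:E)%E.
Proof.
move=> mK PK mf fb b0.
have mp := measurable_funepos mf; have mn := measurable_funeneg mf.
have nb x : K x -> (f^\- x <= b%:E)%E.
  move=> Kx; rewrite funenegE ge_max; apply/andP; split; last by rewrite lee_fin.
  by rewrite leeNl -EFinN; exact: fb.
have icst : (\int[P]_(x in K) b%:E = b%:E)%E.
  by rewrite integral_cst// -[RHS]mule1; congr (_ * _)%E.
have Nfin : (\int[P]_(x in K) f^\- x)%E \is a fin_num.
  rewrite ge0_fin_numE; last exact: integral_ge0.
  apply: (@le_lt_trans _ _ (\int[P]_(x in K) b%:E)%E); last by rewrite icst ltry.
  by apply: ge0_le_integral.
have fb0 x : K x -> (0 <= f x + b%:E)%E.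
  move=> Kx; have := fb x Kx; rewrite EFinN.
  by case: (f x) => [r||]//=; rewrite -?EFinD ?lee_fin -?EFinN ?lee_fin ?leey//; lra.
have mfb : measurable_fun K (fun x => f x + b%:E)%E.
  by apply: emeasurable_funD => //; exact: measurable_cst.
have : (\int[P]_(x in K) (f x + b%:E) + \int[P]_(x in K) f^\- x =
        \int[P]_(x in K) f^\+ x + b%:E)%E.
  rewrite -[in RHS]icst -ge0_integralD//.
  rewrite -[RHS]ge0_integralD//.
  apply: eq_integral => x; rewrite inE => Kx.
  have mfin : (f^\- x)%E \is a fin_num.
    by rewrite ge0_fin_numE ?funeneg_ge0// (le_lt_trans (nb x Kx))// ltry.
  have -> : f x = (f^\+ x - f^\- x)%E by rewrite {1}(funeposneg f).
  by rewrite addeAC subeK.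
move=> h; rewrite [in RHS](integralE P K f).
by rewrite addeAC -h addeK.
Qed.

Section energies.
Context (R : realType) (n : nat) (K : set 'rV[R]_n) (cK : compact K) (D : R).
Hypothesis HD : forall x y, K x -> K y -> enorm (x - y) <= D.
Local Notation T := (borelRn R n).
Local Notation KK := ((K : set T) `*` (K : set T)).
Implicit Types (p q : R) (mu nu : probability T R).

Definition shifted_kern p (z : T * T) : \bar R := (kern p (edist z) + (D ^+ 2 / 2)%:E)%E.

Definition shifted_energy p mu := energy (K : set T) (shifted_kern p) mu.

Let mK : measurable (K : set T) := compact_borel cK.

Lemma shift_ge0 : 0 <= D ^+ 2 / 2.
Proof. by rewrite divr_ge0// sqr_ge0. Qed.

Lemma measurable_kern_edist p : measurable_fun setT (fun z : T * T => kern p (edist z)).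
Proof. exact: (measurableT_comp (measurable_kern p) (@measurable_edist R n)). Qed.

Lemma measurable_shifted_kern p (A : set (T * T)) : measurable_fun A (shifted_kern p).
Proof.
apply: measurable_funTS; apply: emeasurable_funD; first exact: measurable_kern_edist.
exact: measurable_cst.
Qed.

Lemma shifted_kern_ge0 p x y : -2 <= p -> K x -> K y -> (0 <= shifted_kern p (x, y))%E.
Proof.
move=> p2 Kx Ky.
have := @kern_ge R D p (edist (x, y)) p2; rewrite enorm_ge0 HD// => /(_ isT).
rewrite /shifted_kern; case: (kern p _) => [r|_|//].
  by rewrite -EFinD !lee_fin; lra.
by rewrite addye ?leey.
Qed.

Lemma shifted_energy_ge0 p mu : -2 <= p -> (0 <= shifted_energy p mu)%E.
Proof.
by move=> p2; apply: integral_ge0 => -[x y] [/= Kx Ky]; exact: shifted_kern_ge0.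
Qed.

Lemma shifted_energy_homo p q mu : -2 <= p -> p <= q ->
  (shifted_energy p mu <= shifted_energy q mu)%E.
Proof.
move=> p2 pq; apply: energy_le => //; try exact: measurable_shifted_kern.
- by move=> x y; exact: shifted_kern_ge0.
- by move=> x y _ _; apply: leeD2r; exact: kern_homo.
Qed.

Lemma log_kernelE (x y : 'rV[R]_n) : log_kernel x y = kern 0 (edist (x, y)).
Proof.
rewrite /log_kernel /kern /edist /= -subr_eq0 -enorm_eq0.
have := enorm_ge0 (x - y); rewrite le_eqVlt eq_sym => /orP[/eqP ->|t0].
  by rewrite eqxx ltxx lexx.
by rewrite gt_eqF// t0 /exp_slope eqxx lnV.
Qed.

(** For 0 < p both sides are +oo on the diagonal; for p < 0 both vanish there. *)
Lemma riesz_kernelE p (x y : 'rV[R]_n) : p != 0 ->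
  riesz_kernel p x y = (p%:E * kern p (edist (x, y)) + 1)%E.
Proof.
move=> p0; rewrite /riesz_kernel /kern /edist /= -[x == y]subr_eq0 -enorm_eq0.
have := enorm_ge0 (x - y); rewrite [0 <= _]le_eqVlt eq_sym => /orP[/eqP ->|t0].
  rewrite eqxx ltxx andbT.
  have [p_gt0|p_le0] := ltP 0 p; first by rewrite (ltW p_gt0) gt0_muley ?lte_fin// addye.
  have p_lt0 : p < 0 by rewrite lt_neqAle p0.
  rewrite (lt_geF p_lt0) powR0 ?oppr_eq0// -EFinM -EFinD mulrN mulfV//.
  by congr (_%:E); lra.
rewrite gt_eqF// andbF t0 /exp_slope (negbTE p0) -EFinM -EFinD /powR gt_eqF//.
by congr (_%:E); rewrite mulrN mulNr; field.
Qed.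

Lemma riesz_kernel_ge0 p (x y : 'rV[R]_n) : (0 <= riesz_kernel p x y)%E.
Proof.
rewrite /riesz_kernel; case: ifPn => _; first by rewrite leey.
by rewrite lee_fin powR_ge0.
Qed.

Lemma measurable_riesz_kernel p (A : set (T * T)) : p != 0 ->
  measurable_fun A (fun z : T * T => riesz_kernel p (z.1 : 'rV[R]_n) z.2).
Proof.
move=> p0; apply: measurable_funTS.
rewrite (_ : (fun z => _) = (fun z => p%:E * kern p (edist z) + 1)%E); last first.
  by apply/funext => -[x y]; rewrite riesz_kernelE.
apply: emeasurable_funD; last exact: measurable_cst.
apply: emeasurable_funM; first exact: measurable_cst.
exact: measurable_kern_edist.
Qed.

Lemma riesz_energy_ofE p mu : p != 0 -> riesz_energy_of p K mu =
  energy (K : set T) (fun z : T * T => riesz_kernel p (z.1 : 'rV[R]_n) z.2) mu.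
Proof.
move=> p0; rewrite -energyE//; first exact: measurable_riesz_kernel.
by move=> x y _ _; exact: riesz_kernel_ge0.
Qed.

(** An affine change of energies, with the terms placed so that all integrands are nonnegative. *)
Lemma shifted_energy_pos p mu : 0 < p -> mu K = 1%E ->
  (p%:E * shifted_energy p mu + 1 = riesz_energy_of p K mu + (p * (D ^+ 2 / 2))%:E)%E.
Proof.
move=> p0 muK; have p2 : -2 <= p by lra.
have pB : 0 <= p * (D ^+ 2 / 2) by rewrite mulr_ge0 ?shift_ge0// ltW.
rewrite riesz_energy_ofE ?gt_eqF// /shifted_energy.
have sk0 x y : K x -> K y -> (0 <= shifted_kern p (x, y))%E by exact: shifted_kern_ge0.
have mr := @measurable_riesz_kernel p KK (lt0r_neq0 p0).
have ms := @measurable_shifted_kern p KK.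
rewrite -energyZ ?ltW// -(energy_cst mK 1 muK) -(energy_cst mK (p * _) muK).
rewrite -!energyD//.
- apply: eq_integral => -[x y] _ /=; rewrite riesz_kernelE ?gt_eqF// /shifted_kern.
  by rewrite muleDr// ?fin_num_adde_defl// -EFinM addeAC.
- by move=> x y _ _; exact: riesz_kernel_ge0.
- by apply: emeasurable_funM => //; exact: measurable_cst.
- by move=> x y Kx Ky; apply: mule_ge0; [rewrite lee_fin ltW|exact: sk0].
Qed.

(** The coefficient - p is positive: a large Riesz energy means a small shifted energy. *)
Lemma shifted_energy_neg p mu : -2 <= p -> p < 0 -> mu K = 1%E ->
  ((- p)%:E * shifted_energy p mu + riesz_energy_of p K mu = (- p * (D ^+ 2 / 2) + 1)%:E)%E.
Proof.
move=> p2 p0 muK; have Np0 : 0 <= - p by lra.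
rewrite riesz_energy_ofE ?lt_eqF// /shifted_energy.
have sk0 x y : K x -> K y -> (0 <= shifted_kern p (x, y))%E by exact: shifted_kern_ge0.
have mr := @measurable_riesz_kernel p KK (ltr0_neq0 p0).
have ms := @measurable_shifted_kern p KK.
rewrite -energyZ// -(energy_cst mK (_ + 1) muK) -!energyD//.
- apply: eq_integral => -[x y] _ /=; rewrite riesz_kernelE ?lt_eqF// /shifted_kern.
  have : kern p (edist (x, y)) \is a fin_num.
    by rewrite /kern; case: ifPn => // _; rewrite (lt_geF p0).
  case: (kern p _) => [r||]// _.
  by rewrite -EFinD; congr (_%:E); ring.
- by apply: emeasurable_funM => //; exact: measurable_cst.
- by move=> x y Kx Ky; apply: mule_ge0; [rewrite lee_fin|exact: sk0].
- by move=> x y _ _; exact: riesz_kernel_ge0.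
Qed.

(** The iterated logarithmic integral has a kernel of variable sign, so the shift is carried through
    the inner and then the outer integral. *)
Lemma shifted_energy0 mu : mu K = 1%E ->
  (shifted_energy 0 mu = log_energy_of K mu + (D ^+ 2 / 2)%:E)%E.
Proof.
move=> muK; have p2 : -2 <= 0 :> R by lra.
have sk0 x y : K x -> K y -> (0 <= shifted_kern 0 (x, y))%E by exact: shifted_kern_ge0.
have lb x y : K x -> K y -> ((- (D ^+ 2 / 2))%:E <= log_kernel x y)%E.
  move=> Kx Ky; have := sk0 x y Kx Ky; rewrite /shifted_kern log_kernelE.
  case: (kern 0 _) => [r|_|//]; last by rewrite leey.
  by rewrite -EFinD !lee_fin; lra.
rewrite /shifted_energy -energyE//; last exact: measurable_shifted_kern.
have mlk (x : T) : measurable_fun setT (fun y : T => log_kernel (x : 'rV[R]_n) y).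
  rewrite (_ : (fun y => _) = (fun y : T => kern 0 (edist (x, y)))); last first.
    by apply/funext => y; rewrite log_kernelE.
  apply: (measurableT_comp (measurable_kern_edist 0)); exact: measurable_pair1.
have inner (x : T) : K x -> (\int[mu]_(y in K) shifted_kern 0 (x, y) =
    \int[mu]_(y in K) log_kernel (x : 'rV[R]_n) y + (D ^+ 2 / 2)%:E)%E.
  move=> Kx; rewrite -integral_bounded_belowD//.
  - by apply: eq_integral => y _; rewrite /shifted_kern log_kernelE.
  - exact: measurable_funTS.
  - by move=> y Ky; exact: lb.
  - exact: shift_ge0.
rewrite (eq_integral (fun x : T =>
  \int[mu]_(y in K) log_kernel (x : 'rV[R]_n) y + (D ^+ 2 / 2)%:E)%E); last first.
  by move=> x; rewrite inE => Kx; exact: inner.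
set I := fun x : T => (\int[mu]_(y in K) log_kernel (x : 'rV[R]_n) y)%E.
have IB (x : T) : K x -> (0 <= I x + (D ^+ 2 / 2)%:E)%E.
  move=> Kx; rewrite /I -inner//; apply: integral_ge0 => y Ky; exact: sk0.
have mIB : measurable_fun (K : set T) (fun x : T => \int[mu]_(y in K) shifted_kern 0 (x, y))%E.
  by apply: measurable_section_integral => //; exact: measurable_shifted_kern.
rewrite (integral_bounded_belowD mK)//.
- apply: (@eq_measurable_fun _ _ _ _ _ (fun x : T =>
    \int[mu]_(y in K) shifted_kern 0 (x, y) - (D ^+ 2 / 2)%:E)%E).
    by move=> x; rewrite inE => Kx; rewrite inner// addeK.
  by apply: emeasurable_funB => //; exact: measurable_cst.
- move=> x Kx; have := IB x Kx; rewrite -/(I x); case: (I x) => [r|_|//]; last by rewrite leey.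
  by rewrite -EFinD !lee_fin; lra.
- exact: shift_ge0.
Qed.

Definition energy_minimizer p mu :=
  mu K = 1%E /\ forall nu, nu K = 1%E -> (shifted_energy p mu <= shifted_energy p nu)%E.

Lemma shifted_energy_pos_le p mu nu : 0 < p -> mu K = 1%E -> nu K = 1%E ->
  (shifted_energy p mu <= shifted_energy p nu)%E =
  (riesz_energy_of p K mu <= riesz_energy_of p K nu)%E.
Proof.
move=> p0 muK nuK.
rewrite -[RHS](leeD2rE (x := (p * (D ^+ 2 / 2))%:E))// -!shifted_energy_pos//.
by rewrite leeD2rE// lee_pmul2l// lte_fin.
Qed.

Lemma shifted_energy0_le mu nu : mu K = 1%E -> nu K = 1%E ->
  (shifted_energy 0 mu <= shifted_energy 0 nu)%E =
  (log_energy_of K mu <= log_energy_of K nu)%E.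
Proof. by move=> muK nuK; rewrite !shifted_energy0// leeD2rE. Qed.

Lemma shifted_energy_neg_fin p mu : -2 <= p -> p < 0 -> mu K = 1%E ->
  exists a b : R, [/\ shifted_energy p mu = a%:E, riesz_energy_of p K mu = b%:E &
    - p * a + b = - p * (D ^+ 2 / 2) + 1].
Proof.
move=> p2 p0 muK; have := shifted_energy_neg p2 p0 muK.
have := shifted_energy_ge0 mu p2.
have : (0 <= riesz_energy_of p K mu)%E.
  by apply: integral_ge0 => x _; apply: integral_ge0 => y _; exact: riesz_kernel_ge0.
have Np0 : 0 < - p by rewrite oppr_gt0.
case: (riesz_energy_of p K mu) => [b||]//; case: (shifted_energy p mu) => [a||]// b0 a0.
- by move=> -[h]; exists a, b.
- by rewrite gt0_muley ?lte_fin// addye.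
- by rewrite gt0_muley ?lte_fin// addye.
Qed.

Lemma shifted_energy_neg_le p mu nu : -2 <= p -> p < 0 -> mu K = 1%E -> nu K = 1%E ->
  (shifted_energy p mu <= shifted_energy p nu)%E =
  (riesz_energy_of p K nu <= riesz_energy_of p K mu)%E.
Proof.
move=> p2 p0 muK nuK.
have [a [b [-> -> h]]] := shifted_energy_neg_fin p2 p0 muK.
have [c [d [-> -> h']]] := shifted_energy_neg_fin p2 p0 nuK.
have Np0 : 0 < - p by rewrite oppr_gt0.
rewrite !lee_fin -(ler_pM2l Np0); apply/idP/idP; lra.
Qed.

Lemma prob_on_nonempty mu : mu K = 1%E -> K !=set0.
Proof.
move=> muK; apply/set0P/negP => /eqP K0; move: muK; rewrite K0 measure0.
by move=> /eqP; rewrite eq_sym onee_eq0.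
Qed.

(** The three relations above identify the extremal problems, for every p >= -2, with the
    minimization of one energy. *)
Lemma attains_energyP p mu : -2 <= p ->
  attains_energy p K mu <-> energy_minimizer p mu.
Proof.
move=> p2; rewrite /attains_energy /energy_minimizer /prob_on.
have [->|p_neq0] := eqVneq p 0.
  split=> -[muK h]; split=> //.
    move=> nu nuK; rewrite shifted_energy0_le // h; by apply: ereal_inf_lbound; exists nu.
  apply/eqP; rewrite eq_le; apply/andP; split; last by apply: ereal_inf_lbound; exists mu.
  by apply: le_ereal_inf_tmp => _ [nu nuK <-]; rewrite -shifted_energy0_le//; exact: h.
rewrite /riesz_energy; case: ifPn => [p0|].
  split=> -[muK h]; split=> //.
    move=> nu nuK; rewrite shifted_energy_pos_le // h; by apply: ereal_inf_lbound; exists nu.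
  apply/eqP; rewrite eq_le; apply/andP; split; last by apply: ereal_inf_lbound; exists mu.
  by apply: le_ereal_inf_tmp => _ [nu nuK <-]; rewrite -shifted_energy_pos_le//; exact: h.
rewrite -leNgt => p_le0; have p0 : p < 0 by rewrite lt_neqAle p_neq0.
split=> -[muK].
  have /set0P/eqP K0 := prob_on_nonempty muK.
  rewrite asboolF// => h; split=> // nu nuK.
  rewrite shifted_energy_neg_le// h; by apply: ereal_sup_ubound; exists nu.
have /set0P/eqP K0 := prob_on_nonempty muK.
move=> h; split=> //; rewrite asboolF//.
apply/eqP; rewrite eq_le; apply/andP; split; first by apply: ereal_sup_ubound; exists mu.
by apply: ge_ereal_sup => _ [nu nuK <-]; rewrite -shifted_energy_neg_le//; exact: h.
Qed.

(** Besides finiteness of the energy, positivity of its infimum is needed, since 0 to a negative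
    power is 0 here; it holds because the kernel is at least (|D| + 1)^(-p) on K. *)
Lemma capacity_gt0 p mu : 0 <= p -> mu K = 1%E -> (shifted_energy p mu < +oo)%E ->
  (0 < capacity p K)%E.
Proof.
rewrite le_eqVlt => /predU1P[<-|p0] muK Jfin.
  rewrite /capacity eqxx.
  have : (log_energy K < +oo)%E.
    apply: (@le_lt_trans _ _ (log_energy_of K mu)); first by apply: ereal_inf_lbound; exists mu.
    move: Jfin; rewrite shifted_energy0//.
    by case: (log_energy_of K mu) => [r||]// _; rewrite ?ltry.
  by case: (log_energy K) => [r||]//= _; rewrite ?lte_fin ?expR_gt0 ?ltry.
have pE : (riesz_energy_of p K mu < +oo)%E.
  have p2 : -2 <= p by lra.
  have Jf : shifted_energy p mu \is a fin_num.
    by rewrite ge0_fin_numE//; exact: shifted_energy_ge0.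
  have := shifted_energy_pos p0 muK; rewrite -(fineK Jf).
  by case: (riesz_energy_of p K mu) => [r||]//; rewrite ltry.
have D10 : 0 < `|D| + 1 by rewrite ltr_wpDl.
set c := (`|D| + 1) `^ (- p).
have c0 : 0 < c by exact: powR_gt0.
have Ec nu : nu K = 1%E -> (c%:E <= riesz_energy_of p K nu)%E.
  move=> nuK; rewrite riesz_energy_ofE ?gt_eqF// -(energy_cst mK c nuK).
  apply: energy_le => //.
  - by apply: measurable_riesz_kernel; rewrite gt_eqF.
  - by move=> x y _ _; rewrite lee_fin ltW.
  move=> x y Kx Ky; rewrite /= /riesz_kernel p0 /= -subr_eq0 -enorm_eq0.
  case: ifPn => [_|t0]; first by rewrite leey.
  rewrite lee_fin /c /powR gt_eqF// (negbTE t0) ler_expR ler_nM2l ?oppr_lt0//.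
  rewrite ler_ln ?posrE//; last by rewrite lt_neqAle eq_sym t0 enorm_ge0.
  by apply: le_trans (HD Kx Ky) _; apply: le_trans (ler_norm _) _; rewrite lerDl.
rewrite /capacity gt_eqF//.
have [r r0 ->] : exists2 r : R, 0 < r & riesz_energy p K = r%:E.
  have : (c%:E <= riesz_energy p K)%E.
    by rewrite /riesz_energy p0; apply: le_ereal_inf_tmp => _ [nu nuK <-]; exact: Ec.
  have : (riesz_energy p K < +oo)%E.
    by apply: le_lt_trans pE; rewrite /riesz_energy p0; apply: ereal_inf_lbound; exists mu.
  case: (riesz_energy p K) => [r||]// _; rewrite lee_fin => cr.
  by exists r => //; exact: lt_le_trans cr.
by rewrite /= lte_fin powR_gt0.
Qed.

Lemma minimizer_energy_fin p mu : 0 <= p -> (0 < capacity p K)%E -> attains_energy p K mu ->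
  (shifted_energy p mu < +oo)%E.
Proof.
rewrite /attains_energy /prob_on /capacity le_eqVlt => /predU1P[<-|p0].
  rewrite eqxx => + [muK h]; rewrite shifted_energy0// h.
  by case: (log_energy K) => [r _|/=|_]; [rewrite ltry|rewrite ltxx|rewrite addNye].
rewrite gt_eqF//; case: ifPn => [|Ep _ [muK h]]; first by rewrite ltxx.
have := shifted_energy_pos p0 muK; rewrite h.
have p2 : -2 <= p by lra.
have := shifted_energy_ge0 mu p2.
case: (shifted_energy p mu) => [r||]//; rewrite ?ltry//.
rewrite gt0_muley ?lte_fin// addye//; move: Ep.
by case: (riesz_energy p K).
Qed.

End energies.

(** * Lower semicontinuity along the ultrafilter *)

(** Monotone convergence, in the one-sided form that lower semicontinuity needs. *)
Lemma energy_sup_le d (T : measurableType d) (R : realType) (mu : probability T R)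
  (K : set T) (u : nat -> T * T -> \bar R) (k : T * T -> \bar R) (C : \bar R) :
  measurable K -> (forall m, measurable_fun (K `*` K) (u m)) -> measurable_fun (K `*` K) k ->
  (forall m x y, K x -> K y -> 0 <= u m (x, y))%E ->
  (forall x y, K x -> K y -> {homo u ^~ (x, y) : m l / (m <= l)%N >-> (m <= l)%E}) ->
  (forall x y, K x -> K y -> 0 <= k (x, y) <= ereal_sup (range (u ^~ (x, y))))%E ->
  (forall m, energy K (u m) mu <= C)%E -> (energy K k mu <= C)%E.
Proof.
move=> mK mu_ mk u0 uh ku uC; have mKK : measurable (K `*` K) by exact: measurableX.
have hcv := cvg_monotone_convergence (mu := (mu \x mu)%E) mKK mu_
  (fun m z (Kz : (K `*` K) z) => ltac:(case: z Kz => x y [/= Kx Ky]; exact: u0))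
  (fun z (Kz : (K `*` K) z) => ltac:(case: z Kz => x y [/= Kx Ky]; exact: uh)).
have ulim x y : K x -> K y -> limn (u ^~ (x, y)) = ereal_sup (range (u ^~ (x, y))).
  by move=> Kx Ky; apply/cvg_lim => //; apply: ereal_nondecreasing_cvgn; exact: uh.
have uis z : (K `*` K) z -> cvgn (u ^~ z).
  case: z => x y [/= Kx Ky]; apply: ereal_nondecreasing_is_cvgn; exact: uh.
apply: (@le_trans _ _ (\int[mu \x mu]_(z in K `*` K) limn (u ^~ z))%E).
  apply: ge0_le_integral => //.
  - by move=> [x y] [/= Kx Ky]; have /andP[] := ku x y Kx Ky.
  - apply: (emeasurable_fun_cvg u) => // z Kz; exact: uis.
  - by move=> [x y] [/= Kx Ky]; rewrite ulim//; have /andP[] := ku x y Kx Ky.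
apply: (cvge_to_le hcv); exact: nearW.
Qed.

Section limit.
Context (R : realType) (n : nat) (K : set 'rV[R]_n) (cK : compact K) (D : R).
Hypothesis HD : forall x y, K x -> K y -> enorm (x - y) <= D.
Hypothesis D1 : 1 <= D.
Local Notation T := (borelRn R n).
Local Notation KK := ((K : set T) `*` (K : set T)).
Let mK : measurable (K : set T) := compact_borel cK.

Variables (I : Type) (U : set_system I) (mu : I -> probability T R) (nu : probability T R).
Hypothesis UU : UltraFilter U.
Hypothesis nuP : forall h : T * T -> R, measurable_fun KK h ->
    (forall x y, K x -> K y -> 0 <= h (x, y)) -> unif_cont_on K h ->
    forall C : R, (\forall i \near U, energy (K : set T) (EFin \o h) (mu i) <= C%:E)%E ->
    (energy (K : set T) (EFin \o h) nu <= C%:E)%E.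

(** The truncations at distance 1/(m+1) are continuous, so their energies pass to the limit measure,
    and they increase to the kernel. The hypothesis 1 <= D keeps them nonnegative: the truncated
    distance max(t, 1/(m+1)) is at most D. *)
Lemma shifted_energy_lsc (p C : R) : -2 <= p ->
  (\forall i \near U, shifted_energy K D p (mu i) <= C%:E)%E ->
  (shifted_energy K D p nu <= C%:E)%E.
Proof.
move=> p2 hC.
pose h (m : nat) (z : T * T) : R := trunc_kern p m.+1%:R^-1 (edist z) + D ^+ 2 / 2.
have inv0 (m : nat) : (0 : R) < m.+1%:R^-1 by rewrite invr_gt0 ltr0Sn.
have inv1 (m : nat) : (m.+1%:R^-1 : R) <= 1 by rewrite invf_le1// ler1n.
have mh m : measurable_fun setT (h m).
  apply: measurable_funD => //; apply: measurableT_comp (@measurable_edist R n).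
  by apply: continuous_measurable_fun; exact: continuous_trunc_kern.
have h0 m x y : K x -> K y -> 0 <= h m (x, y).
  move=> Kx Ky; set t := Num.max (edist (x, y)) m.+1%:R^-1.
  have t0 : 0 < t by rewrite lt_max inv0 orbT.
  have tD : 0 <= t <= D.
    by rewrite (ltW t0)/= ge_max HD//=; exact: le_trans (inv1 m) D1.
  have := kern_ge p2 tD; rewrite /kern t0 lee_fin -/(trunc_kern _ _ _) /h; lra.
have hle m x y : ((h m (x, y))%:E <= shifted_kern D p (x, y))%E.
  by rewrite /h EFinD; apply: leeD2r; apply: trunc_kern_le => //; exact: enorm_ge0.
apply: (@energy_sup_le _ _ _ nu K (fun m => EFin \o h m)) => //.
- by move=> m; apply: measurable_funTS; exact/measurable_EFinP.
- exact: measurable_shifted_kern.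
- move=> x y Kx Ky m l ml; rewrite /= lee_fin lerD2r; apply: trunc_kern_homo => //.
  by rewrite lef_pV2 ?posrE ?ltr0Sn// ler_nat.
- move=> x y Kx Ky; rewrite (shifted_kern_ge0 HD)//=.
  rewrite /shifted_kern -leeBrDr//; apply: le_trans (kern_sup_trunc p (enorm_ge0 _)) _.
  apply: ge_ereal_sup => _ [m _ <-]; rewrite leeBrDr// -EFinD.
  by apply: ereal_sup_ubound; exists m.
- move=> m; apply: nuP.
  + exact: measurable_funTS.
  + exact: h0.
  + apply: unif_cont_on_within => //; apply: continuous_subspaceT => z.
    apply: cvgD; last exact: cvg_cst.
    apply: (continuous_comp (f := fun z : 'rV[R]_n * 'rV[R]_n => enorm (z.1 - z.2))).
      exact: continuous_edist.
    exact: continuous_trunc_kern.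
  apply: filterS hC => i; apply: le_trans; apply: energy_le => //.
  + by apply: measurable_funTS; exact/measurable_EFinP.
  + exact: measurable_shifted_kern.
  + by move=> x y Kx Ky; rewrite lee_fin; exact: h0.
  + by move=> x y _ _; exact: hle.
Qed.

(** A function of one variable is a kernel, shifted by M to be nonnegative. *)
Lemma energy_of_fst (f : 'rV[R]_n -> R) (M : R) (m : probability T R) :
  {within K, continuous f} -> (forall x, K x -> `|f x| <= M) -> 0 <= M ->
  m K = 1%E ->
  energy (K : set T) (EFin \o (fun z : T * T => f z.1 + M)) m =
  ((\int[m]_(x in K) f x)%R + M)%:E.
Proof.
move=> cf fM M0 muK; have mf := measurable_within_continuous cK cf.
have f0 x : K x -> - M <= f x by move=> /fM; rewrite ler_norml => /andP[].
have fM0 x : K x -> 0 <= f x + M by move=> /f0; lra.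
have mE : measurable_fun (K : set T) (EFin \o (f : T -> R)) by exact/measurable_EFinP.
have mfst : measurable_fun KK (fun z : T * T => f z.1).
  apply: (measurable_comp (F := K : set T) (f := (f : T -> R)) (g := fst)) => //.
    by move=> _ [z [Kz _] <-].
  exact: measurable_funTS measurable_fst.
have icst (c : R) : (\int[m]_(x in (K : set T)) c%:E = c%:E)%E.
  by rewrite integral_cst//= -[RHS]mule1; congr (_ * _)%E.
rewrite -(@energyE _ T R K mK)//; first last.
- by move=> x y Kx Ky; rewrite /= lee_fin; exact: fM0.
- by apply/measurable_EFinP; apply: measurable_funD => //; exact: measurable_cst.
transitivity (\int[m]_(x in (K : set T)) ((f x)%:E + M%:E))%E.
  apply: eq_integral => x _; rewrite -EFinD.
  exact: (icst (f x + M)).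
rewrite integral_bounded_belowD//.
rewrite EFinD /Rintegral fineK//.
rewrite fin_num_abs; apply: (@le_lt_trans _ _ M%:E); last exact: ltry.
apply: le_trans (le_abse_integral _ _ _) _ => //.
rewrite -(icst M); apply: ge0_le_integral => //.
- by apply: measurableT_comp.
Qed.

Lemma integral_limit_le (f : 'rV[R]_n -> R) (c : R) :
  {within K, continuous f} -> (\forall i \near U, mu i K = 1%E) -> nu K = 1%E ->
  (\forall i \near U, (\int[mu i]_(x in K) f x)%R <= c) ->
  (\int[nu]_(x in K) f x)%R <= c.
Proof.
move=> cf muK nuK fc.
have [M M0 fM] : exists2 M : R, 0 <= M & forall x, K x -> `|f x| <= M.
  have /compact_bounded[M [_ HM]] : compact (f @` K) by exact: continuous_compact.
  exists (`|M| + 1) => [|x Kx]; first by rewrite addr_ge0.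
  by apply: HM; [rewrite ltr_pwDr// ler_norm|exists x].
rewrite -(lerD2r M) -lee_fin -energy_of_fst//.
have mf := measurable_within_continuous cK cf.
have mfst : measurable_fun KK (fun z : T * T => f z.1).
  apply: (measurable_comp (F := K : set T) (f := (f : T -> R)) (g := fst)) => //.
    by move=> _ [z [Kz _] <-].
  exact: measurable_funTS measurable_fst.
apply: nuP.
- by apply: measurable_funD => //; exact: measurable_cst.
- by move=> x y /fM Kx _; move: Kx; rewrite ler_norml => /andP[] /=; lra.
- move=> e e0; have [r r0 Hr] := heine_cantor cK cf e0.
  exists r => // x y x' y' Kx Ky Kx' Ky' xx' _ /=.
  by rewrite (_ : _ - _ = f x - f x'); [exact: Hr|ring].
apply: filterS2 muK fc => i muK fc.
by rewrite energy_of_fst// lee_fin lerD2r.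
Qed.

End limit.

(** * Weak-star continuity of equilibrium measures *)

(** If convergence failed, some ultrafilter finer than F would keep g on one side of L at distance e. *)
Lemma cvg_of_ultra (R : realType) (I : Type) (F : set_system I) (g : I -> R) (L : R) :
  ProperFilter F ->
  (forall U, UltraFilter U -> F `<=` U ->
     forall c, (\forall i \near U, g i <= c) -> L <= c) ->
  (forall U, UltraFilter U -> F `<=` U ->
     forall c, (\forall i \near U, c <= g i) -> c <= L) ->
  g @ F --> L.
Proof.
move=> PF ub lb; apply/cvgrPdist_lt => e e0; apply: contrapT => nF.
pose A := [set i | ~ `|L - g i| < e].
have PW : ProperFilter (within A F).
  apply: Build_ProperFilter_ex => B FB; apply: contrapT => nB; apply: nF.
  have FAB : F [set i | A i -> B i] by exact: FB.
  suff : F [set i | `|L - g i| < e] by [].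
  apply: filterS FAB => i /= Wi; apply: contrapT => Ai.
  by apply: nB; exists i; exact: Wi.
have [U [UU WU]] := ultraFilterLemma PW.
have FU : F `<=` U by move=> B FB; apply: WU; apply: filterS FB => i Bi _.
have UA : U A by apply: WU; exact: withinT.
have [Ule|Ugt] := in_ultra_setVsetC [set i | g i <= L - e] UU.
  by have := ub U UU FU _ Ule; lra.
have : L + e <= L; last by lra.
apply: (lb U UU FU); apply: filterS2 UA Ugt => i /= Ai /negP; rewrite -ltNge => gi.
rewrite leNgt; apply/negP => gi'; apply: Ai; rewrite ltr_norml; apply/andP; split; lra.
Qed.

Section main.
Context (R : realType) (n : nat) (K : set 'rV[R]_n) (cK : compact K) (D : R).
Hypothesis HD : forall x y, K x -> K y -> enorm (x - y) <= D.
Hypothesis D1 : 1 <= D.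
Local Notation T := (borelRn R n).
Local Notation KK := ((K : set T) `*` (K : set T)).
Let mK : measurable (K : set T) := compact_borel cK.
Variables (q : R) (q2 : -2 < q) (mu : R -> probability T R).
Hypothesis muq : is_equilibrium_measure q K (mu q).

Let muqK : mu q K = 1%E.
Proof. by have [[]] := muq. Qed.

(** Any limit measure minimizes the q-energy, hence equals mu q by uniqueness, and upper
    bounds along U on the integrals of f and of - f pass to mu q. *)
Lemma weak_star_cvg_of_limits (F : set_system R) : ProperFilter F ->
  (\forall p \near F, mu p K = 1%E) ->
  (forall (U : set_system R) (nu : probability T R), UltraFilter U -> F `<=` U ->
    (forall p C : R, -2 <= p ->
      (\forall i \near U, shifted_energy K D p (mu i) <= C%:E)%E ->
      (shifted_energy K D p nu <= C%:E)%E) ->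
    (shifted_energy K D q nu <= shifted_energy K D q (mu q))%E) ->
  weak_star_cvg K mu F (mu q).
Proof.
move=> PF muK Hlim f cf.
have H (U : set_system R) (g : 'rV[R]_n -> R) c : {within K, continuous g} ->
    UltraFilter U -> F `<=` U ->
    (\forall p \near U, (\int[mu p]_(x in K) g x)%R <= c) ->
    (\int[mu q]_(x in K) g x)%R <= c.
  move=> cg UU FU gc.
  have muKU : \forall p \near U, mu p K = 1%E by exact: FU.
  have [nu nuK nuP] := prob_ultra_limit cK UU muKU.
  have nuq : attains_energy q K nu.
    apply/(attains_energyP cK HD _ (ltW q2)); split=> // xi xiK.
    apply: le_trans (Hlim U nu UU FU _) _.
      by move=> p C p2; exact: (shifted_energy_lsc cK HD D1 UU nuP).
    have /(attains_energyP cK HD _ (ltW q2))[_] := muq.1; exact.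
  have -> : (\int[mu q]_(x in K) g x)%R = (\int[nu]_(x in K) g x)%R.
    rewrite /Rintegral; congr fine; apply: eq_measure_integral => A mA _.
    by apply/esym; exact: muq.2.
  exact: (integral_limit_le cK UU nuP cg muKU nuK gc).
apply: cvg_of_ultra => U UU FU c hc; first exact: (H U).
have cNf : {within K, continuous (fun x => - f x)}.
  by move=> x; apply: cvgN; exact: cf.
have RN (p : R) : (\int[mu p]_(x in K) (- f x))%R = - (\int[mu p]_(x in K) f x)%R.
  under eq_Rintegral do rewrite -mulN1r.
  rewrite RintegralZl ?mulN1r//.
  apply: measurable_bounded_integrable => //.
  - exact: le_lt_trans (probability_le1 (mu p) mK) (ltry 1).
  - exact: measurable_within_continuous.
  have /compact_bounded[M [Mr HM]] : compact (f @` K) by exact: continuous_compact.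
  by exists M; split=> // m Mm x Kx; apply: HM => //; exists x.
have := H U _ (- c) cNf UU FU; rewrite RN lerN2; apply.
by apply: filterS hc => p hp; rewrite RN lerN2.
Qed.

Lemma equilibrium_minimizer p : -2 <= p -> is_equilibrium_measure p K (mu p) ->
  energy_minimizer K D p (mu p).
Proof. by move=> p2 [] /(attains_energyP cK HD _ p2). Qed.

Hypothesis muqfin : (shifted_energy K D q (mu q) < +oo)%E.

Let C := fine (shifted_energy K D q (mu q)).
Let CE : shifted_energy K D q (mu q) = C%:E.
Proof.
by rewrite fineK// ge0_fin_numE//; apply: (shifted_energy_ge0 HD); exact: ltW.
Qed.

(** Energies of exponents r < q are bounded first, then r increases to q. *)
Lemma weak_star_left :
  (\forall p \near q^'-, is_equilibrium_measure p K (mu p)) ->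
  weak_star_cvg K mu q^'- (mu q).
Proof.
move=> eqp.
have near2 : \forall p \near q^'-, -2 < p by exact: nbhs_left_gt.
apply: weak_star_cvg_of_limits.
  by apply: filterS eqp => p [[]].
move=> U nu UU FU lsc.
have Jr r : -2 <= r -> r < q -> (shifted_energy K D r nu <= C%:E)%E.
  move=> r2 rq; apply: lsc => //; apply: FU.
  near=> p.
  have rp : r <= p by apply: ltW; near: p; exact: nbhs_left_gt.
  have p2 : -2 <= p by apply: le_trans rp.
  have pq : p <= q by apply: ltW; near: p; exact: nbhs_left_lt.
  apply: (le_trans (shifted_energy_homo cK HD (mu p) r2 rp)).
  have [_ hm] : energy_minimizer K D p (mu p).
    apply: (equilibrium_minimizer p2).
    by near: p; exact: eqp.
  apply: (le_trans (hm _ muqK)); rewrite -CE.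
  exact: shifted_energy_homo.
rewrite CE.
(* The maximum keeps the exponents in the range where shifted kernels are nonnegative. *)
pose v (m : nat) := Num.max (-2) (q - m.+1%:R^-1).
have v2 m : -2 <= v m by rewrite le_max lexx.
have vq m : v m < q by rewrite gt_max q2/= ltrBlDr ltrDl invr_gt0.
apply: (@energy_sup_le _ _ _ nu K (fun m => shifted_kern D (v m))) => //.
- by move=> m; exact: measurable_shifted_kern.
- exact: measurable_shifted_kern.
- by move=> m x y Kx Ky; exact: (shifted_kern_ge0 HD).
- move=> x y Kx Ky m l ml; apply: leeD2r; apply: kern_homo.
  rewrite /v ge_max le_max lexx/= le_max; apply/orP; right.
  by rewrite lerD2l lerN2 lef_pV2 ?posrE ?ltr0Sn// ler_nat.
- move=> x y Kx Ky; rewrite (shifted_kern_ge0 HD)//=; last exact: ltW.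
  rewrite /shifted_kern -leeBrDr//; apply: le_trans (kern_sup_left q _) _.
  apply: ge_ereal_sup => _ [m _ <-]; rewrite leeBrDr//.
  apply: (@le_trans _ _ (shifted_kern D (v m) (x, y))).
    by apply: leeD2r; apply: kern_homo; rewrite le_max lexx orbT.
  by apply: ereal_sup_ubound; exists m.
- by move=> m; exact: Jr.
Unshelve. all: by end_near.
Qed.

(** Dominated convergence along exponents decreasing from qs to q; monotonicity in the exponent
    turns one good exponent p into a whole right neighbourhood. *)
Lemma shifted_energy_right_cvg qs : q < qs -> (shifted_energy K D qs (mu q) < +oo)%E ->
  forall e : R, 0 < e -> exists2 p : R, q < p &
    (shifted_energy K D p (mu q) <= (C + e)%:E)%E.
Proof.
move=> qqs Jfin e e0; have mKK : measurable KK by exact: measurableX.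
pose u (m : nat) := q + (qs - q) * m.+1%:R^-1.
have uq m : q < u m by rewrite ltrDl mulr_gt0 ?subr_gt0// invr_gt0.
have u2 m : -2 <= u m by apply: ltW; exact: lt_trans (uq m).
have qs2 : -2 <= qs by apply: ltW; exact: lt_trans qqs.
have uqs m : u m <= qs.
  rewrite /u -lerBrDl ler_piMr ?subr_ge0 ?(ltW qqs)//.
  by rewrite invf_le1// ler1n.
have ucvg : u @ \oo --> q.
  rewrite -[X in _ --> X]addr0 -(mulr0 (qs - q)); apply: cvgD; first exact: cvg_cst.
  apply: cvgM; first exact: cvg_cst.
  exact: cvg_harmonic.
have [] := @dominated_convergence _ _ _ (mu q \x mu q)%E KK mKK (fun m => shifted_kern D (u m))
  (shifted_kern D q) (shifted_kern D qs).
- by move=> m; exact: measurable_shifted_kern.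
- exact: measurable_shifted_kern.
- apply: aeW => -[x y] [/= Kx Ky].
  apply: cvgeD => //; last exact: cvg_cst.
    by rewrite fin_num_adde_defl.
  by apply: kern_cvg_right => // m; exact: ltW.
- apply/integrableP; split; first exact: measurable_shifted_kern.
  apply: le_lt_trans Jfin; rewrite /shifted_energy /energy le_eqVlt; apply/orP; left; apply/eqP.
  apply: eq_integral => -[x y]; rewrite inE => -[/= Kx Ky].
  by rewrite gee0_abs// (shifted_kern_ge0 HD).
- apply: aeW => -[x y] m [/= Kx Ky].
  rewrite gee0_abs ?(shifted_kern_ge0 HD)//.
  by apply: leeD2r; exact: kern_homo.
move=> _ _ hcv.
have {}hcv : shifted_energy K D (u m) (mu q) @[m --> \oo] --> C%:E by rewrite -CE.
have : nbhs (C%:E) [set x : \bar R | (x < (C + e)%:E)%E].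
  by apply: open_nbhs_nbhs; split; [exact: open_ereal_lt_ereal|rewrite /= lte_fin ltrDl].
move=> /hcv[m _ /(_ m (leqnn m))] /= /ltW hm.
by exists (u m).
Qed.

Lemma weak_star_right qs : q < qs -> (shifted_energy K D qs (mu q) < +oo)%E ->
  (\forall p \near q^'+, is_equilibrium_measure p K (mu p)) ->
  weak_star_cvg K mu q^'+ (mu q).
Proof.
move=> qqs Jfin eqp.
apply: weak_star_cvg_of_limits.
  by apply: filterS eqp => p [[]].
move=> U nu UU FU lsc.
rewrite CE; apply/lee_addgt0Pr => e e0; rewrite -EFinD.
apply: lsc; first exact: ltW.
have [p0 qp0 hp0] := shifted_energy_right_cvg qqs Jfin e0.
apply: FU; near=> p.
have qp : q <= p by apply: ltW; near: p; exact: nbhs_right_gt.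
have pp0 : p <= p0 by apply: ltW; near: p; exact: nbhs_right_lt.
have p2 : -2 <= p by apply: le_trans qp; exact: ltW.
apply: (le_trans (shifted_energy_homo cK HD (mu p) (ltW q2) qp)).
have [_ hm] : energy_minimizer K D p (mu p).
  apply: (equilibrium_minimizer p2).
  by near: p; exact: eqp.
apply: (le_trans (hm _ muqK)).
exact: le_trans (shifted_energy_homo cK HD (mu q) p2 pp0) hp0.
Unshelve. all: by end_near.
Qed.

End main.

Theorem theorem1p5 (R : realType) (n : nat) (n_gt0 : (0 < n)%N)
    (K : set 'rV[R]_n) (K_compact : compact K)
    (q : R) (cap_gt0 : (0 < capacity q K)%E)
    (mu : R -> probability (borelRn R n) R)
    (mu_equilibrium : forall p : R, equilibrium_exponent K p ->
       is_equilibrium_measure p K (mu p)) :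
  [/\ (* (a) *)
      -2 < q < 0 -> weak_star_cvg K mu (nbhs q) (mu q),
      (* (b) *)
      0 <= q -> weak_star_cvg K mu q^'- (mu q)
    & (* (c) *)
      0 <= q ->
      (exists2 qs : R, q < qs & (riesz_energy_of qs K (mu q) < +oo)%E) ->
      weak_star_cvg K mu q^'+ (mu q)].
Proof.
have [D0 HD0] := edist_bounded K_compact.
(* The lower bound 1 on D accommodates the truncations of the kernels. *)
pose D := Num.max 1 D0.
have HD x y : K x -> K y -> enorm (x - y) <= D.
  by move=> Kx Ky; rewrite le_max HD0 ?orbT.
have D1 : 1 <= D by rewrite le_max lexx.
have eq_ge0 : 0 <= q -> is_equilibrium_measure q K (mu q).
  by move=> q0; apply: mu_equilibrium; left.
have fin_ge0 : 0 <= q -> (shifted_energy K D q (mu q) < +oo)%E.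
  by move=> q0; exact: (minimizer_energy_fin K_compact HD q0 cap_gt0 (eq_ge0 q0).1).
have exponent_of_fin p qs : 0 <= p -> p <= qs -> mu q K = 1%E ->
    (shifted_energy K D qs (mu q) < +oo)%E -> equilibrium_exponent K p.
  move=> p0 pqs muqK Jfin; left; split; first exact: p0.
  apply: (capacity_gt0 K_compact HD p0 muqK); apply: le_lt_trans Jfin.
  apply: (shifted_energy_homo K_compact HD _ _ pqs); lra.
split.
- move=> /andP[q2 q0].
  have Kn0 : K !=set0.
    apply/set0P/negP => /eqP K0; move: cap_gt0.
    have E0 : riesz_energy q K = 0%E by rewrite /riesz_energy (lt_gtF q0) asboolT.
    rewrite /capacity (lt_eqF q0) E0 /= powR0 ?ltxx//.
    by rewrite oppr_eq0 invr_eq0 lt_eqF.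
  have exp_neg p : -2 < p -> p < 0 -> is_equilibrium_measure p K (mu p).
    by move=> p2 p0; apply: mu_equilibrium; right; rewrite p2 p0.
  have muq := exp_neg q q2 q0.
  have fin_neg p : -2 <= p -> p < 0 -> (shifted_energy K D p (mu q) < +oo)%E.
    move=> p2 p0; have [[muqK _] _] := muq.
    by have [a [b [-> _ _]]] := shifted_energy_neg_fin K_compact HD p2 p0 muqK; rewrite ltry.
  have left_cvg : weak_star_cvg K mu q^'- (mu q).
    apply: (weak_star_left K_compact HD D1 q2 muq (fin_neg q (ltW q2) q0)).
    near=> p; apply: exp_neg; first by near: p; exact: nbhs_left_gt.
    by apply: (@lt_trans _ _ q) => //; near: p; exact: nbhs_left_lt.
  have right_cvg : weak_star_cvg K mu q^'+ (mu q).
    have qq2 : q < q / 2 by lra.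
    have J2 : (shifted_energy K D (q / 2) (mu q) < +oo)%E by apply: fin_neg; lra.
    apply: (weak_star_right K_compact HD D1 q2 muq (fin_neg q (ltW q2) q0) qq2 J2).
    near=> p; apply: exp_neg; last by near: p; exact: nbhs_right_lt.
    by apply: (@lt_trans _ _ q) => //; near: p; exact: nbhs_right_gt.
  move=> f cf; apply/left_right_continuousP; split; [exact: left_cvg|exact: right_cvg].
- move=> q0; have q2 : -2 < q by lra.
  have [[muqK _] _] := eq_ge0 q0.
  apply: (weak_star_left K_compact HD D1 q2 (eq_ge0 q0) (fin_ge0 q0)).
  have [q_gt0|q_le0] := ltP 0 q.
    near=> p; apply: mu_equilibrium.
    apply: (exponent_of_fin p q _ _ muqK (fin_ge0 q0)); apply: ltW; near: p.
      exact: nbhs_left_gt.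
    exact: nbhs_left_lt.
  have q00 : q = 0 by apply/eqP; rewrite eq_le q_le0.
  near=> p; apply: mu_equilibrium; right; split; last exact: (prob_on_nonempty muqK).
  apply/andP; split; first by near: p; exact: nbhs_left_gt.
  by rewrite -q00; near: p; exact: nbhs_left_lt.
- move=> q0 [qs qqs Efin]; have q2 : -2 < q by lra.
  have [[muqK _] _] := eq_ge0 q0.
  have qs0 : 0 < qs by exact: le_lt_trans qqs.
  have qs2 : -2 <= qs by lra.
  have Jfin : (shifted_energy K D qs (mu q) < +oo)%E.
    have := shifted_energy_pos K_compact HD qs0 muqK.
    have := shifted_energy_ge0 HD (mu q) qs2.
    have : (0 <= riesz_energy_of qs K (mu q))%E.
      by apply: integral_ge0 => x _; apply: integral_ge0 => y _; exact: riesz_kernel_ge0.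
    move: Efin; case: (riesz_energy_of qs K (mu q)) => [e||]// _ _.
    case: (shifted_energy K D qs (mu q)) => [r||]// _; first by rewrite ltry.
    by rewrite gt0_muley ?lte_fin// addye.
  apply: (weak_star_right K_compact HD D1 q2 (eq_ge0 q0) (fin_ge0 q0) qqs Jfin).
  near=> p; apply: mu_equilibrium.
  apply: (exponent_of_fin p qs _ _ muqK Jfin); last by apply: ltW; near: p; exact: nbhs_right_lt.
  by apply: (le_trans q0); apply: ltW; near: p; exact: nbhs_right_gt.
Unshelve. all: by end_near.
Qed.
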